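(* For the Ces\`aro operator $\mathcal{C}$ acting from $H^\infty$ to the $\alpha$-Bloch space $\mathcal{B}^\alpha$: $$3\le\|\mathcal{C}\|_{H^\infty\to\mathcal{B}^\alpha}\le 4\quad\text{if }\alpha=1,\qquad \frac32\le\|\mathcal{C}\|_{H^\infty\to\mathcal{B}^\alpha}\le 4\quad\text{if }\alpha>1.$$ Moreover, $\mathcal{C}$ is not bounded from $H^\infty$ to $\mathcal{B}^\alpha$ when $0<\alpha<1$.
   Context: $\mathbb{D}$ is the open unit disc and $H(\mathbb{D})$ the space of analytic functions on $\mathbb{D}$. For $f(z)=\sum_{k\ge0}a_kz^k\in H(\mathbb{D})$ the Ces\`aro operator is $\mathcal{C}(f)(z)=\sum_{n\ge0}\Big(\frac{1}{n+1}\sum_{k=0}^n a_k\Big)z^n=\int_0^1\frac{f(tz)}{1-tz}\,dt$. $H^\infty$ is the space of bounded analytic functions on $\mathbb{D}$ with norm $\|f\|_\infty=\sup_{z\in\mathbb{D}}|f(z)|$. For $\alpha>0$ the $\alpha$-Bloch space $\mathcal{B}^\alpha$ consists of $f\in H(\mathbb{D})$ with $\sup_{z\in\mathbb{D}}(1-|z|^2)^\alpha|f'(z)|<\infty$, normed by $\|f\|_{\mathcal{B}^\alpha}=|f(0)|+\sup_{z\in\mathbb{D}}(1-|z|^2)^\alpha|f'(z)|$. Operator norms are $\|\mathcal{C}\|_{X\to Y}=\sup\{\|\mathcal{C}f\|_Y:\|f\|_X\le 1\}$. *)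

(* Defs.v *)
From Stdlib Require Import Reals.
From Coquelicot Require Import Coquelicot.
Open Scope R_scope.

Definition inD (z : C) : Prop := Cmod z < 1.

Definition holo (f : C -> C) : Prop :=
  forall z, inD z -> @ex_derive C_AbsRing C_NormedModule f z.

Definition cint01 (g : R -> C) : C :=
  (RInt (fun t => fst (g t)) 0 1, RInt (fun t => snd (g t)) 0 1).

Definition cesaro (f : C -> C) : C -> C :=
  fun z => cint01 (fun t => (f (RtoC t * z) / (1 - RtoC t * z))%C).

Definition Hinf_norm (f : C -> C) : Rbar :=
  Lub_Rbar (fun r => exists z, inD z /\ r = Cmod (f z)).

Definition bloch_norm (alpha : R) (f : C -> C) : Rbar :=
  Rbar_plus (Finite (Cmod (f (RtoC 0))))
    (Lub_Rbar (fun r => exists z l, inD z /\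
        @is_derive C_AbsRing C_NormedModule f z l /\
        r = Rpower (1 - Cmod z ^ 2) alpha * Cmod l)).

(* ||C||_{H^oo -> B^alpha} = sup { ||C f||_{B^alpha} : f in H(D), ||f||_oo <= 1 }
   (value +oo exactly when C is not bounded H^oo -> B^alpha). *)
Definition cesaro_opnorm (alpha : R) : Rbar :=
  Lub_Rbar (fun r => exists f, holo f /\ Rbar_le (Hinf_norm f) (Finite 1) /\
                               Rbar_le (Finite r) (bloch_norm alpha (cesaro f))).

(* Main.v *)
Require Import Defs.
From Stdlib Require Import Reals Lra Lia Classical ClassicalEpsilon.
From Coquelicot Require Import Coquelicot.
Open Scope R_scope.

(** Write [g w = f w / (1 - w)], [F = cesaro f] and [r = |z|].  Differentiating
    [s F (s z) = \int_0^s g (t z) dt] at [s = 1] gives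
    [z F' z = g z - \int_0^1 g (t z) dt].  With [J = \int_0^1 dt / (1 - t r)], the
    bound [|f| <= 1] alone yields [r |F' z| <= 1 / (1 - r) + J], while the Cauchy
    estimate [|f' w| <= 1 / (1 - |w|)] yields [|g' w| <= 2 / (1 - |w|)^2] and hence
    [r |F' z| <= 2 / (1 - r) - 2 J].  A convex combination of the two for
    [r >= 4/5], and the second one with a Taylor minorant of [J] for [r <= 4/5],
    give [(1 - r^2) |F' z| <= 3].

    The Cauchy estimate is obtained for merely differentiable [f] by Goursat's
    bisection argument, applied on rectangles to [f (w + exp z) exp (- z)], whose
    mean over a vertical period does not depend on the abscissa and tends to
    [f' w] at [-oo].

    The lower bounds come from [f = 1] at real points: [x = 0] and [x -> 1]. *)

(** * Goursat's theorem for rectangles *)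

(* The circulation of the form [P dx + Q dy] around [[a, b] x [c, d]]. *)
Definition circ (P Q : R -> R -> R) (a b c d : R) : R :=
  RInt (fun y => Q b y) c d - RInt (fun y => Q a y) c d
  - (RInt (fun x => P x d) a b - RInt (fun x => P x c) a b).

(** The shared coefficient [p2] encodes dP/dy = dQ/dx. Differentiability is asked at the point only,
    with no continuity of the partials, so closedness is exploited through bisection and not through
    an area integral. *)
Definition closed_form_at (P Q : R -> R -> R) (x y : R) : Prop :=
  exists p1 p2 q2, differentiable_pt_lim P x y p1 p2 /\
                   differentiable_pt_lim Q x y p2 q2.

Lemma differentiable_continuous_l (f : R -> R -> R) x y lx ly :
  differentiable_pt_lim f x y lx ly -> continuous (fun t => f t y) x.
Proof.
  intros H.
  apply (ex_derive_continuous (fun t => f t y)).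
  exists (lx * 1 + ly * 0). apply is_derive_Reals.
  apply (derivable_pt_lim_comp_2d f (fun t => t) (fun _ => y)).
  - exact H.
  - apply derivable_pt_lim_id.
  - apply derivable_pt_lim_const.
Qed.

Lemma differentiable_continuous_r (f : R -> R -> R) x y lx ly :
  differentiable_pt_lim f x y lx ly -> continuous (fun t => f x t) y.
Proof.
  intros H.
  apply (ex_derive_continuous (fun t => f x t)).
  exists (lx * 0 + ly * 1). apply is_derive_Reals.
  apply (derivable_pt_lim_comp_2d f (fun _ => x) (fun t => t)).
  - exact H.
  - apply derivable_pt_lim_const.
  - apply derivable_pt_lim_id.
Qed.

Lemma RInt_split (f : R -> R) a b c :
  ex_RInt f a b -> ex_RInt f b c -> RInt f a c = RInt f a b + RInt f b c.
Proof. intros H1 H2. symmetry. exact (RInt_Chasles f a b c H1 H2). Qed.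

Section HalfPlane.

Variables (P Q : R -> R -> R) (B : R).
Hypothesis closed : forall x y, x < B -> closed_form_at P Q x y.

Lemma ex_RInt_vertical x c d : x < B -> ex_RInt (fun y => Q x y) c d.
Proof.
  intros Hx. apply (ex_RInt_continuous (fun y => Q x y)). intros y _.
  destruct (closed x y Hx) as (p1 & p2 & q2 & _ & HQ).
  exact (differentiable_continuous_r _ _ _ _ _ HQ).
Qed.

Lemma ex_RInt_horizontal y a b : a < B -> b < B -> ex_RInt (fun x => P x y) a b.
Proof.
  intros Ha Hb. apply (ex_RInt_continuous (fun x => P x y)). intros x [_ Hx].
  assert (x < B) by (apply Rle_lt_trans with (1 := Hx); apply Rmax_lub_lt; auto).
  destruct (closed x y H) as (p1 & p2 & q2 & HP & _).
  exact (differentiable_continuous_l _ _ _ _ _ HP).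
Qed.

(** Each inner side is traversed twice, in opposite directions, and cancels. *)
Lemma circ_quarters a b c d m n : a < B -> b < B -> m < B ->
  circ P Q a b c d =
    circ P Q a m c n + circ P Q m b c n + circ P Q a m n d + circ P Q m b n d.
Proof.
  intros Ha Hb Hm. unfold circ.
  rewrite (RInt_split (fun y => Q b y) c n d) by (apply ex_RInt_vertical; auto).
  rewrite (RInt_split (fun y => Q a y) c n d) by (apply ex_RInt_vertical; auto).
  rewrite (RInt_split (fun x => P x d) a m b) by (apply ex_RInt_horizontal; auto).
  rewrite (RInt_split (fun x => P x c) a m b) by (apply ex_RInt_horizontal; auto).
  ring.
Qed.

(** Serves to replace [P] or [Q] on one side of a small rectangle by its linear approximation; [m]
    is the coordinate of the centre of expansion. *)
Lemma RInt_affine (f : R -> R) (k0 k1 m a b e : R) : a <= b ->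
  ex_RInt f a b ->
  (forall t, a <= t <= b -> Rabs (f t - (k0 + k1 * (t - m))) <= e) ->
  Rabs (RInt f a b - ((b - a) * k0 + k1 * ((b - m) ^ 2 - (a - m) ^ 2) / 2))
    <= (b - a) * e.
Proof.
  intros Hab Hf He.
  assert (HL : is_RInt (fun t => k0 + k1 * (t - m)) a b
                 ((b - a) * k0 + k1 * ((b - m) ^ 2 - (a - m) ^ 2) / 2)).
  { evar_last.
    apply (is_RInt_derive (fun t => k0 * t + k1 * (t - m) ^ 2 / 2)).
    - intros x _. auto_derive; [easy | field].
    - intros x _. apply (ex_derive_continuous (fun t => k0 + k1 * (t - m))).
      auto_derive. easy.
    - unfold minus, plus, opp; simpl. field. }
  rewrite <- (is_RInt_unique _ _ _ _ HL).
  assert (Hex : ex_RInt (fun t => k0 + k1 * (t - m)) a b) by (eexists; exact HL).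
  replace (RInt f a b - RInt (fun t => k0 + k1 * (t - m)) a b)
    with (RInt (fun t => f t - (k0 + k1 * (t - m))) a b)
    by exact (RInt_minus f _ a b Hf Hex).
  apply abs_RInt_le_const; auto.
  exact (ex_RInt_minus f _ a b Hf Hex).
Qed.

(** The affine parts of [P] and [Q] contribute nothing, because [p2] is common to both. On each side
    the remainder is at most eps / 2 times the half-perimeter [s], and the four sides have total
    length 2 s. *)
Lemma circ_small u v : u < B -> forall eps, 0 < eps ->
  exists delta, 0 < delta /\ forall a b c d,
    a <= u <= b -> c <= v <= d -> b < B -> b - a < delta -> d - c < delta ->
    Rabs (circ P Q a b c d) <= eps * (b - a + (d - c)) ^ 2.
Proof.
  intros Hu eps Heps.
  destruct (closed u v Hu) as (p1 & p2 & q2 & HP & HQ).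
  assert (He2 : 0 < eps / 2) by lra.
  destruct (HP (mkposreal _ He2)) as [d1 H1].
  destruct (HQ (mkposreal _ He2)) as [d2 H2].
  simpl in H1, H2.
  exists (Rmin d1 d2). split.
  { apply Rmin_glb_lt; [apply d1 | apply d2]. }
  intros a b c d Hab Hcd HbB Hd1 Hd2.
  assert (Hm1 := Rmin_l d1 d2). assert (Hm2 := Rmin_r d1 d2).
  set (s := b - a + (d - c)) in *.
  assert (Hin : forall x y, a <= x <= b -> c <= y <= d ->
            Rabs (x - u) < Rmin d1 d2 /\ Rabs (y - v) < Rmin d1 d2 /\
            Rmax (Rabs (x - u)) (Rabs (y - v)) <= s).
  { intros x y Hx Hy. repeat split; try (apply Rabs_def1; lra).
    apply Rmax_lub; apply Rabs_le; unfold s; lra. }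
  assert (EP : forall x y, a <= x <= b -> c <= y <= d ->
     Rabs (P x y - (P u v + p2 * (y - v) + p1 * (x - u))) <= eps / 2 * s).
  { intros x y Hx Hy. destruct (Hin x y Hx Hy) as (A1 & A2 & A3).
    eapply Rle_trans; [ | apply Rmult_le_compat_l; [lra | exact A3]].
    replace (P x y - _) with (P x y - P u v - (p1 * (x - u) + p2 * (y - v))) by ring.
    apply H1; lra. }
  assert (EQ : forall x y, a <= x <= b -> c <= y <= d ->
     Rabs (Q x y - (Q u v + p2 * (x - u) + q2 * (y - v))) <= eps / 2 * s).
  { intros x y Hx Hy. destruct (Hin x y Hx Hy) as (A1 & A2 & A3).
    eapply Rle_trans; [ | apply Rmult_le_compat_l; [lra | exact A3]].
    replace (Q x y - _) with (Q x y - Q u v - (p2 * (x - u) + q2 * (y - v))) by ring.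
    apply H2; lra. }
  assert (F1 := RInt_affine (fun y => Q b y) (Q u v + p2 * (b - u)) q2 v c d (eps / 2 * s)
    ltac:(lra) (ex_RInt_vertical b c d ltac:(lra)) (fun y Hy => EQ b y ltac:(lra) Hy)).
  assert (F2 := RInt_affine (fun y => Q a y) (Q u v + p2 * (a - u)) q2 v c d (eps / 2 * s)
    ltac:(lra) (ex_RInt_vertical a c d ltac:(lra)) (fun y Hy => EQ a y ltac:(lra) Hy)).
  assert (F3 := RInt_affine (fun x => P x d) (P u v + p2 * (d - v)) p1 u a b (eps / 2 * s)
    ltac:(lra) (ex_RInt_horizontal d a b ltac:(lra) ltac:(lra)) (fun x Hx => EP x d Hx ltac:(lra))).
  assert (F4 := RInt_affine (fun x => P x c) (P u v + p2 * (c - v)) p1 u a b (eps / 2 * s)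
    ltac:(lra) (ex_RInt_horizontal c a b ltac:(lra) ltac:(lra)) (fun x Hx => EP x c Hx ltac:(lra))).
  unfold circ.
  apply Rabs_le_between in F1, F2, F3, F4.
  apply Rabs_le_between.
  assert (E : eps * s ^ 2 = 2 * ((d - c) * (eps / 2 * s)) + 2 * ((b - a) * (eps / 2 * s)))
    by (unfold s; field).
  rewrite E.
  match type of F1 with _ <= ?x - ?y <= _ => set (I1 := x) in * end.
  match type of F2 with _ <= ?x - ?y <= _ => set (I2 := x) in * end.
  match type of F3 with _ <= ?x - ?y <= _ => set (I3 := x) in * end.
  match type of F4 with _ <= ?x - ?y <= _ => set (I4 := x) in * end.
  clearbody I1 I2 I3 I4.
  nra.
Qed.

(** The threshold is quadratic in the half-perimeter, so the thresholds of the four quarters add up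
    exactly to that of the whole; one quarter must exceed its own. *)
Lemma circ_bisect eps a c w h : 0 < w -> 0 < h -> a + w < B ->
  eps * (w + h) ^ 2 < Rabs (circ P Q a (a + w) c (c + h)) ->
  exists a' c', a <= a' <= a + w / 2 /\ c <= c' <= c + h / 2 /\
    eps * (w / 2 + h / 2) ^ 2
      < Rabs (circ P Q a' (a' + w / 2) c' (c' + h / 2)).
Proof.
  intros Hw Hh HB H.
  apply NNPP. intros N.
  assert (K : forall a' c', a <= a' <= a + w / 2 -> c <= c' <= c + h / 2 ->
     Rabs (circ P Q a' (a' + w / 2) c' (c' + h / 2)) <= eps * (w / 2 + h / 2) ^ 2).
  { intros a' c' Ha Hc. apply Rnot_lt_le. intros L. apply N. exists a', c'. auto. }
  rewrite (circ_quarters a (a + w) c (c + h) (a + w / 2) (c + h / 2)) in H by lra.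
  assert (K1 := K a c ltac:(lra) ltac:(lra)).
  assert (K2 := K (a + w / 2) c ltac:(lra) ltac:(lra)).
  assert (K3 := K a (c + h / 2) ltac:(lra) ltac:(lra)).
  assert (K4 := K (a + w / 2) (c + h / 2) ltac:(lra) ltac:(lra)).
  replace (a + w / 2 + w / 2) with (a + w) in * by field.
  replace (c + h / 2 + h / 2) with (c + h) in * by field.
  apply Rlt_not_le in H. apply H.
  apply Rabs_le_between in K1, K2, K3, K4. apply Rabs_le_between.
  replace (eps * (w + h) ^ 2) with (4 * (eps * (w / 2 + h / 2) ^ 2)) by field.
  lra.
Qed.

Lemma circ_bisect_sequence eps a c w h : 0 < w -> 0 < h -> a + w < B ->
  eps * (w + h) ^ 2 < Rabs (circ P Q a (a + w) c (c + h)) ->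
  exists s : nat -> R * R, s O = (a, c) /\ forall n,
    let k := 2 ^ n in
    fst (s n) <= fst (s (S n)) <= fst (s n) + w / k / 2 /\
    snd (s n) <= snd (s (S n)) <= snd (s n) + h / k / 2 /\
    eps * (w / k + h / k) ^ 2
      < Rabs (circ P Q (fst (s n)) (fst (s n) + w / k)
                       (snd (s n)) (snd (s n) + h / k)).
Proof.
  intros Hw Hh HB H.
  set (good n (p : R * R) := fst p + w / 2 ^ n < B /\
    eps * (w / 2 ^ n + h / 2 ^ n) ^ 2
      < Rabs (circ P Q (fst p) (fst p + w / 2 ^ n) (snd p) (snd p + h / 2 ^ n))).
  set (next n (p q : R * R) :=
    fst p <= fst q <= fst p + w / 2 ^ n / 2 /\
    snd p <= snd q <= snd p + h / 2 ^ n / 2).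
  (* The premise [good n p] sits inside the existential so that a choice exists for every pair, and
     [s] can be defined by recursion before its terms are known to be good. *)
  assert (step : forall n p, exists q, good n p -> good (S n) q /\ next n p q).
  { intros n [x y].
    destruct (classic (good n (x, y))) as [[G1 G2] | G]; [ | exists (x, y); tauto].
    simpl fst in *; simpl snd in *.
    assert (Hk : 0 < / 2 ^ n) by (apply Rinv_0_lt_compat, pow_lt; lra).
    destruct (circ_bisect eps x y (w / 2 ^ n) (h / 2 ^ n)) as (x' & y' & A1 & A2 & A3); auto.
    1, 2: unfold Rdiv; apply Rmult_lt_0_compat; auto.
    exists (x', y'). intros _. unfold good, next; simpl fst; simpl snd.
    replace (w / 2 ^ S n) with (w / 2 ^ n / 2) by (simpl; field; apply pow_nonzero; lra).
    replace (h / 2 ^ S n) with (h / 2 ^ n / 2) by (simpl; field; apply pow_nonzero; lra).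
    repeat split; try tauto.
    lra. }
  set (nx np := proj1_sig (constructive_indefinite_description _ (step (fst np) (snd np)))).
  assert (Hnx : forall np, good (fst np) (snd np) ->
                  good (S (fst np)) (nx np) /\ next (fst np) (snd np) (nx np))
    by (intros np; apply (proj2_sig (constructive_indefinite_description _ (step _ _)))).
  set (s := fix s n := match n with O => (a, c) | S n => nx (n, s n) end).
  assert (Hs : forall n, good n (s n)).
  { induction n as [ | n IH].
    - unfold good; simpl. rewrite !Rdiv_1_r. auto.
    - apply (Hnx (n, s n)). exact IH. }
  exists s. split; [easy | ]. intros n k.
  destruct (Hnx (n, s n) (Hs n)) as [_ [N1 N2]].
  split; [exact N1 | ]. split; [exact N2 | ]. apply (Hs n).
Qed.

(** The intervals from u n to u n + w / 2^n are nested, so the supremum of the left ends lies in all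
    of them. *)
Lemma nested_point (u : nat -> R) (w : R) : 0 < w ->
  (forall n, u n <= u (S n) <= u n + w / 2 ^ n / 2) ->
  exists l, forall n, u n <= l <= u n + w / 2 ^ n.
Proof.
  intros Hw Hu.
  assert (Hhalf : forall n, w / 2 ^ S n = w / 2 ^ n / 2)
    by (intros; simpl; field; apply pow_nonzero; lra).
  assert (Hpos : forall n, 0 < w / 2 ^ n)
    by (intros; apply Rdiv_lt_0_compat; [easy | apply pow_lt; lra]).
  assert (Hup : forall n m, u n <= u (n + m)%nat).
  { intros n m. induction m as [ | m IH]; [rewrite Nat.add_0_r; lra | ].
    rewrite Nat.add_succ_r. destruct (Hu (n + m)%nat). lra. }
  assert (Hdown : forall n m, u (n + m)%nat + w / 2 ^ (n + m) <= u n + w / 2 ^ n).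
  { intros n m. induction m as [ | m IH]; [rewrite Nat.add_0_r; lra | ].
    rewrite Nat.add_succ_r, Hhalf. destruct (Hu (n + m)%nat). lra. }
  assert (Hle : forall n m, u m <= u n + w / 2 ^ n).
  { intros n m.
    destruct (Nat.le_gt_cases n m) as [L | L].
    - replace m with (n + (m - n))%nat by lia.
      assert (A := Hdown n (m - n)%nat). assert (A' := Hpos (n + (m - n))%nat). lra.
    - replace n with (m + (n - m))%nat by lia.
      assert (A := Hup m (n - m)%nat). assert (A' := Hpos (m + (n - m))%nat). lra. }
  destruct (completeness (fun x => exists n, x = u n)) as [l [L1 L2]].
  - exists (u O + w / 2 ^ 0). intros x [n ->]. apply Hle.
  - exists (u O), O. easy.
  - exists l. intros n. split.
    + apply L1. exists n. easy.
    + apply L2. intros x [m ->]. apply Hle.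
Qed.

(** Goursat's argument: a nonzero circulation would survive along bisected rectangles shrinking to a
    point (u, v), against [circ_small] at that point. *)
Lemma circ_zero a b c d : a < b -> c < d -> b < B -> circ P Q a b c d = 0.
Proof.
  intros Hab Hcd HB.
  apply NNPP. intros N.
  set (w := b - a). set (h := d - c).
  assert (Hw : 0 < w) by (unfold w; lra). assert (Hh : 0 < h) by (unfold h; lra).
  (* Half of the initial ratio, so that the starting rectangle exceeds its threshold strictly. *)
  set (eps := Rabs (circ P Q a b c d) / 2 / (w + h) ^ 2).
  assert (HA := Rabs_pos_lt _ N).
  assert (Hs2 : 0 < (w + h) ^ 2) by nra.
  assert (Heps : 0 < eps) by (unfold eps; apply Rdiv_lt_0_compat; lra).
  destruct (circ_bisect_sequence eps a c w h) as (s & S0 & HS); auto.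
  { unfold w; lra. }
  { replace (a + w) with b by (unfold w; ring). replace (c + h) with d by (unfold h; ring).
    unfold eps. field_simplify; lra. }
  destruct (nested_point (fun n => fst (s n)) w Hw (fun n => proj1 (HS n))) as [u Hu].
  destruct (nested_point (fun n => snd (s n)) h Hh (fun n => proj1 (proj2 (HS n)))) as [v Hv].
  assert (HuB : u < B).
  { specialize (Hu O). rewrite S0 in Hu. simpl in Hu. unfold w in Hu. lra. }
  destruct (circ_small u v HuB eps Heps) as (delta & Hd & Hsm).
  destruct (pow_lt_1_zero (1 / 2) ltac:(rewrite Rabs_pos_eq; lra)
              (delta / (w + h)) ltac:(apply Rdiv_lt_0_compat; lra)) as [n Hn].
  specialize (Hn n (le_n n)).
  destruct (HS n) as (_ & _ & A). specialize (Hu n). specialize (Hv n). simpl in A, Hu, Hv.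
  assert (Hk : 0 < / 2 ^ n) by (apply Rinv_0_lt_compat, pow_lt; lra).
  assert (E : (1 / 2) ^ n = / 2 ^ n) by (rewrite <- pow_inv; f_equal; field).
  rewrite E, Rabs_pos_eq in Hn by lra.
  apply (Rmult_lt_compat_r (w + h)) in Hn; [ | lra].
  replace (delta / (w + h) * (w + h)) with delta in Hn by (field; lra).
  assert (Hwk : 0 < w / 2 ^ n) by (apply Rmult_lt_0_compat; auto).
  assert (Hhk : 0 < h / 2 ^ n) by (apply Rmult_lt_0_compat; auto).
  assert (Hsum : w / 2 ^ n + h / 2 ^ n < delta) by (unfold Rdiv; lra).
  apply Rlt_not_le in A. apply A.
  eapply Rle_trans; [apply Hsm; try lra | apply Req_le; ring].
  assert (forall m, fst (s m) + w / 2 ^ m <= b).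
  { induction m as [ | m IH].
    - rewrite S0. simpl. unfold w. lra.
    - destruct (HS m) as [[_ K] _].
      replace (w / 2 ^ S m) with (w / 2 ^ m / 2) by (simpl; field; apply pow_nonzero; lra).
      simpl in K. lra. }
  specialize (H n). lra.
Qed.

End HalfPlane.

(** * Complex derivatives and the Cauchy estimate *)

(** An epsilon-delta form of [is_derive] over [C_AbsRing], suited to explicit estimates with
    [Cmod]. *)
Definition has_Cderiv (f : C -> C) (z l : C) : Prop :=
  forall eps, 0 < eps -> exists delta, 0 < delta /\
    forall w, Cmod (w - z) < delta ->
      Cmod (f w - f z - l * (w - z)) <= eps * Cmod (w - z).

Lemma is_derive_has_Cderiv (f : C -> C) (z l : C) :
  @is_derive C_AbsRing C_NormedModule f z l <-> has_Cderiv f z l.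
Proof.
  split.
  - intros [_ H] eps Heps.
    destruct (H z (fun P HP => HP) (mkposreal eps Heps)) as [d Hd].
    exists d. split; [apply d | ]. intros w Hw.
    specialize (Hd w Hw). change (Cmod (f w - f z - (w - z) * l) <= eps * Cmod (w - z)) in Hd.
    rewrite (Cmult_comm l). exact Hd.
  - intros H. split.
    + apply (@is_linear_scal_l C_AbsRing C_NormedModule).
    + intros x Hx.
      rewrite <- (@is_filter_lim_locally_unique C_AbsRing (AbsRing_NormedModule C_AbsRing) z x Hx).
      intros eps. destruct (H eps (cond_pos eps)) as (d & Hd & K).
      exists (mkposreal d Hd). intros w Hw. specialize (K w Hw).
      rewrite (Cmult_comm l) in K. exact K.
Qed.

Lemma Cmod_pair (a b : R) : Cmod (a, b) = sqrt (a ^ 2 + b ^ 2).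
Proof. reflexivity. Qed.

Lemma fst_le_Cmod (z : C) : Rabs (fst z) <= Cmod z.
Proof. eapply Rle_trans; [apply Rmax_l | apply Rmax_Cmod]. Qed.

Lemma snd_le_Cmod (z : C) : Rabs (snd z) <= Cmod z.
Proof. eapply Rle_trans; [apply Rmax_r | apply Rmax_Cmod]. Qed.

Lemma Cmod_unit (y : R) : Cmod (cos y, sin y) = 1.
Proof.
  rewrite Cmod_pair. rewrite <- sqrt_1. f_equal.
  generalize (sin2_cos2 y). unfold Rsqr. lra.
Qed.

(** Turns a bound on real parts, valid for all unit multiples, into a bound on the modulus. This
    lets the analysis below run on real-valued functions and integrals. *)
Lemma Cmod_rotation (z : C) : exists k : C, Cmod k = 1 /\ (k * z)%C = RtoC (Cmod z).
Proof.
  destruct (Req_dec (Cmod z) 0) as [E | E].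
  - exists 1%C. rewrite Cmod_1. split; [easy | ].
    rewrite (Cmod_eq_0 z E), Cmod_0. ring.
  - exists (Cconj z / Cmod z)%C.
    assert (N : RtoC (Cmod z) <> 0%C) by (intros K; apply E; injection K; easy).
    split.
    + rewrite Cmod_div by easy. rewrite Cmod_conj, Cmod_R, Rabs_pos_eq by apply Cmod_ge_0.
      field. easy.
    + assert (K : (RtoC (Cmod z) * RtoC (Cmod z) = z * Cconj z)%C).
      { rewrite <- Cmod2_conj. rewrite <- RtoC_mult. f_equal. ring. }
      replace (Cconj z / Cmod z * z)%C with (z * Cconj z / Cmod z)%C by (field; easy).
      rewrite <- K. field. easy.
Qed.

Lemma has_Cderiv_scal (k : C) f z l : Cmod k = 1 ->
  has_Cderiv f z l -> has_Cderiv (fun w => k * f w)%C z (k * l)%C.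
Proof.
  intros Hk H eps Heps. destruct (H eps Heps) as (d & Hd & K).
  exists d. split; [easy | ]. intros w Hw.
  replace (k * f w - k * f z - k * l * (w - z))%C
    with (k * (f w - f z - l * (w - z)))%C by ring.
  rewrite Cmod_mult, Hk, Rmult_1_l. auto.
Qed.

(** The Cauchy-Riemann equations. The factors sqrt 2 come from comparing the modulus with the
    maximum norm of [differentiable_pt_lim]. *)
Lemma has_Cderiv_differentiable f x y l : has_Cderiv f (x, y) l ->
  differentiable_pt_lim (fun u v => fst (f (u, v))) x y (fst l) (- snd l) /\
  differentiable_pt_lim (fun u v => snd (f (u, v))) x y (snd l) (fst l).
Proof.
  intros H.
  assert (K : forall eps : posreal, locally_2d (fun u v =>
    Cmod (f (u, v) - f (x, y) - l * ((u, v) - (x, y)))%C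
      <= eps * Rmax (Rabs (u - x)) (Rabs (v - y))) x y).
  { intros eps.
    assert (H2 := Rlt_sqrt2_0).
    destruct (H (eps / sqrt 2)) as (d & Hd & Hf).
    { apply Rdiv_lt_0_compat; [apply eps | easy]. }
    assert (Hd2 : 0 < d / sqrt 2) by (apply Rdiv_lt_0_compat; easy).
    exists (mkposreal _ Hd2). simpl. intros u v Hu Hv.
    assert (M := Cmod_2Rmax ((u, v) - (x, y))%C). simpl in M.
    fold (u - x) (v - y) in M.
    assert (E : d = sqrt 2 * (d / sqrt 2)) by (field; lra).
    eapply Rle_trans.
    - apply Hf. eapply Rle_lt_trans; [exact M | ]. rewrite E.
      apply Rmult_lt_compat_l; [easy | ]. apply Rmax_lub_lt; easy.
    - apply Rle_trans with (eps / sqrt 2 * (sqrt 2 * Rmax (Rabs (u - x)) (Rabs (v - y)))).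
      + apply Rmult_le_compat_l; [ | exact M].
        apply Rlt_le, Rdiv_lt_0_compat; [apply eps | easy].
      + apply Req_le. field. lra. }
  split; intros eps; destruct (K eps) as [d Hd]; exists d; intros u v Hu Hv;
    (eapply Rle_trans; [ | apply (Hd u v Hu Hv)]).
  - eapply Rle_trans; [ | apply fst_le_Cmod]. apply Req_le. f_equal. simpl. ring.
  - eapply Rle_trans; [ | apply snd_le_Cmod]. apply Req_le. f_equal. simpl. ring.
Qed.

(** * Differentiation rules in two real variables *)

Lemma differentiable_pt_lim_mult f g x y fx fy gx gy :
  differentiable_pt_lim f x y fx fy -> differentiable_pt_lim g x y gx gy ->
  differentiable_pt_lim (fun u v => f u v * g u v) x y
    (fx * g x y + f x y * gx) (fy * g x y + f x y * gy).
Proof.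
  intros Hf Hg.
  replace (fx * g x y + f x y * gx) with (g x y * fx + f x y * gx) by ring.
  replace (fy * g x y + f x y * gy) with (g x y * fy + f x y * gy) by ring.
  apply (differentiable_pt_lim_comp (fun a b => a * b)); auto.
  (* The remainder of multiplication is the product of the two increments, so [eps] itself is an
     admissible radius. *)
  intros eps. exists eps. intros u v Hu Hv.
  replace (u * v - _ - _) with ((u - f x y) * (v - g x y)) by ring.
  rewrite Rabs_mult. apply Rmult_le_compat; try apply Rabs_pos; [lra | apply Rmax_r].
Qed.

Lemma differentiable_pt_lim_plus f g x y fx fy gx gy :
  differentiable_pt_lim f x y fx fy -> differentiable_pt_lim g x y gx gy ->
  differentiable_pt_lim (fun u v => f u v + g u v) x y (fx + gx) (fy + gy).
Proof.
  intros Hf Hg.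
  replace (fx + gx) with (1 * fx + 1 * gx) by ring.
  replace (fy + gy) with (1 * fy + 1 * gy) by ring.
  apply (differentiable_pt_lim_comp (fun a b => a + b)); auto.
  intros eps. exists eps. intros u v Hu Hv.
  replace (u + v - _ - _) with 0 by ring.
  rewrite Rabs_R0. apply Rmult_le_pos; [apply Rlt_le, eps | ].
  eapply Rle_trans; [apply Rabs_pos | apply Rmax_l].
Qed.

Lemma differentiable_pt_lim_snd f x y l : is_derive f y l ->
  differentiable_pt_lim (fun _ v => f v) x y 0 l.
Proof.
  intros H eps.
  destruct (differentiable_pt_lim_proj1_0 f y x l (proj1 (is_derive_Reals _ _ _) H) eps)
    as [d Hd].
  exists d. intros u v Hu Hv. specialize (Hd v u Hv Hu).
  rewrite Rmax_comm, Rplus_comm. exact Hd.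
Qed.

Lemma differentiable_pt_lim_fst f x y l : is_derive f x l ->
  differentiable_pt_lim (fun u _ => f u) x y l 0.
Proof. intros H. apply differentiable_pt_lim_proj1_0, is_derive_Reals, H. Qed.

(* [logU + i logV] is the function [f (w + exp z) exp (- z)] of [z = x + i y]. *)
Definition log_pt (w : C) (x y : R) : C :=
  (fst w + exp x * cos y, snd w + exp x * sin y).

Definition logU (f : C -> C) (w : C) (x y : R) : R :=
  exp (- x) * (cos y * fst (f (log_pt w x y)) + sin y * snd (f (log_pt w x y))).

Definition logV (f : C -> C) (w : C) (x y : R) : R :=
  exp (- x) * (cos y * snd (f (log_pt w x y)) + (- sin y) * fst (f (log_pt w x y))).

(** For G = U + i V the form V dx + U dy is the imaginary part of G dz. It is the convenient one
    because its integral over a vertical side is that of U, the real part of G. *)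
Lemma log_closed f w x y l : has_Cderiv f (log_pt w x y) l ->
  closed_form_at (logV f w) (logU f w) x y.
Proof.
  intros H. destruct (has_Cderiv_differentiable _ _ _ _ H) as [H1 H2].
  assert (Hc : differentiable_pt_lim (fun _ v => cos v) x y 0 (- sin y))
    by (apply differentiable_pt_lim_snd; auto_derive; [easy | ring]).
  assert (Hs : differentiable_pt_lim (fun _ v => sin v) x y 0 (cos y))
    by (apply differentiable_pt_lim_snd; auto_derive; [easy | ring]).
  assert (Hs' : differentiable_pt_lim (fun _ v => - sin v) x y 0 (- cos y))
    by (apply differentiable_pt_lim_snd; auto_derive; [easy | ring]).
  assert (He : differentiable_pt_lim (fun u _ => exp u) x y (exp x) 0)
    by (apply differentiable_pt_lim_fst; auto_derive; [easy | ring]).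
  assert (He' : differentiable_pt_lim (fun u _ => exp (- u)) x y (- exp (- x)) 0)
    by (apply differentiable_pt_lim_fst; auto_derive; [easy | ring]).
  assert (Hw : forall k : R, differentiable_pt_lim (fun _ _ => k) x y 0 0).
  { intros k. apply (differentiable_pt_lim_fst (fun _ => k)). auto_derive; easy. }
  assert (HA := differentiable_pt_lim_plus _ _ _ _ _ _ _ _ (Hw (fst w))
                  (differentiable_pt_lim_mult _ _ _ _ _ _ _ _ He Hc)).
  assert (HB := differentiable_pt_lim_plus _ _ _ _ _ _ _ _ (Hw (snd w))
                  (differentiable_pt_lim_mult _ _ _ _ _ _ _ _ He Hs)).
  assert (K1 := differentiable_pt_lim_comp _ _ _ _ _ _ _ _ _ _ _ H1 HA HB).
  assert (K2 := differentiable_pt_lim_comp _ _ _ _ _ _ _ _ _ _ _ H2 HA HB).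
  simpl in K1, K2.
  assert (GU := differentiable_pt_lim_mult _ _ _ _ _ _ _ _ He'
    (differentiable_pt_lim_plus _ _ _ _ _ _ _ _
      (differentiable_pt_lim_mult _ _ _ _ _ _ _ _ Hc K1)
      (differentiable_pt_lim_mult _ _ _ _ _ _ _ _ Hs K2))).
  assert (GV := differentiable_pt_lim_mult _ _ _ _ _ _ _ _ He'
    (differentiable_pt_lim_plus _ _ _ _ _ _ _ _
      (differentiable_pt_lim_mult _ _ _ _ _ _ _ _ Hc K2)
      (differentiable_pt_lim_mult _ _ _ _ _ _ _ _ Hs' K1))).
  simpl in GU, GV.
  eexists _, _, _. split; [exact GV | ].
  (* With all partials computed by the product and chain rules, [ring] checks U_x = V_y. *)
  match type of GU with differentiable_pt_lim _ _ _ ?p ?q =>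
    match goal with |- differentiable_pt_lim _ _ _ ?p' _ =>
      replace p' with p by ring end end.
  exact GU.
Qed.

Lemma log_pt_eq w x y : log_pt w x y = (w + RtoC (exp x) * (cos y, sin y))%C.
Proof.
  unfold log_pt, Cplus, Cmult, RtoC. simpl. f_equal; ring.
Qed.

Lemma log_pt_dist w x y : Cmod (log_pt w x y - w) = exp x.
Proof.
  rewrite log_pt_eq.
  replace (w + RtoC (exp x) * (cos y, sin y) - w)%C with (RtoC (exp x) * (cos y, sin y))%C by ring.
  rewrite Cmod_mult, Cmod_unit, Cmod_R, Rabs_pos_eq by (apply Rlt_le, exp_pos). ring.
Qed.

Lemma log_pt_inD w x y : exp x < 1 - Cmod w -> inD (log_pt w x y).
Proof.
  intros H. unfold inD.
  replace (log_pt w x y) with ((log_pt w x y - w) + w)%C by ring.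
  eapply Rle_lt_trans; [apply Cmod_triangle | ]. rewrite log_pt_dist. lra.
Qed.

Lemma rot_component_le (z : C) y : Rabs (cos y * fst z + sin y * snd z) <= Cmod z.
Proof.
  replace (cos y * fst z + sin y * snd z) with (fst (z * Cconj (cos y, sin y))%C)
    by (simpl; ring).
  eapply Rle_trans; [apply fst_le_Cmod | ].
  rewrite Cmod_mult, Cmod_conj, Cmod_unit. lra.
Qed.

(** * The Cauchy estimate at a point from means over circles *)

Section Cauchy.

Variables (f : C -> C) (w l : C).
Hypothesis f_holo : forall z, inD z -> exists l, has_Cderiv f z l.
Hypothesis f_bound : forall z, inD z -> Cmod (f z) <= 1.
Hypothesis w_inD : inD w.
Hypothesis f_deriv : has_Cderiv f w l.

(** The vertical line of abscissa x is mapped onto the circle of radius exp x about [w]; for x < B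
    this circle lies in the unit disc. *)
Let B := ln (1 - Cmod w).

Lemma exp_lt_radius x : x < B -> exp x < 1 - Cmod w.
Proof.
  intros H. apply exp_increasing in H. unfold B in H. rewrite exp_ln in H; [easy | ].
  unfold inD in w_inD. lra.
Qed.

(** On a rectangle whose height is one period 2 PI, the two horizontal integrals agree by
    periodicity, so the vanishing circulation equates the vertical ones. *)
Lemma logU_mean_constant a b : a < b -> b < B ->
  RInt (fun y => logU f w b y) 0 (2 * PI) = RInt (fun y => logU f w a y) 0 (2 * PI).
Proof.
  intros Hab Hb.
  assert (Hpi := PI_RGT_0).
  assert (K : circ (logV f w) (logU f w) a b 0 (2 * PI) = 0).
  { apply (circ_zero _ _ B); auto; [ | lra].
    intros x y Hx. destruct (f_holo (log_pt w x y)) as [l' Hl'].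
    { apply log_pt_inD, exp_lt_radius, Hx. }
    exact (log_closed f w x y l' Hl'). }
  unfold circ in K.
  assert (E : RInt (fun x => logV f w x (2 * PI)) a b = RInt (fun x => logV f w x 0) a b).
  { apply RInt_ext. intros x _. unfold logV, log_pt.
    rewrite cos_2PI, sin_2PI, cos_0, sin_0. easy. }
  lra.
Qed.

Lemma ex_RInt_logU a c d : a < B -> ex_RInt (fun y => logU f w a y) c d.
Proof.
  intros Ha. apply (ex_RInt_vertical (logV f w) (logU f w) B); auto.
  intros x y Hx. destruct (f_holo (log_pt w x y)) as [l' Hl'].
  { apply log_pt_inD, exp_lt_radius, Hx. }
  exact (log_closed f w x y l' Hl').
Qed.

Lemma logU_mean_le b : b < B ->
  RInt (fun y => logU f w b y) 0 (2 * PI) <= 2 * PI * exp (- b).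
Proof.
  intros Hb. assert (Hpi := PI_RGT_0).
  eapply Rle_trans; [apply Rle_abs | ].
  replace (2 * PI * exp (- b)) with ((2 * PI - 0) * exp (- b)) by ring.
  apply abs_RInt_le_const; [lra | now apply ex_RInt_logU | ].
  intros y _. unfold logU. rewrite Rabs_mult, (Rabs_pos_eq (exp _)) by (apply Rlt_le, exp_pos).
  rewrite <- (Rmult_1_r (exp (- b))) at 2.
  apply Rmult_le_compat_l; [apply Rlt_le, exp_pos | ].
  eapply Rle_trans; [apply rot_component_le | apply f_bound].
  apply log_pt_inD, exp_lt_radius, Hb.
Qed.

(* The term [f(w) exp (- z)] has mean zero, so only [f'(w)] survives as [x] tends to [-oo]. *)
Lemma logU_mean_ge eps : 0 < eps -> exists X, forall a, a < X -> a < B ->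
  2 * PI * (fst l - eps) <= RInt (fun y => logU f w a y) 0 (2 * PI).
Proof.
  intros Heps. assert (Hpi := PI_RGT_0).
  destruct (f_deriv eps Heps) as (d & Hd & K).
  exists (ln d). intros a Ha HaB.
  assert (Hed : exp a < d).
  { apply exp_increasing in Ha. rewrite exp_ln in Ha; easy. }
  (* A minorant of the integrand: the rotated constant f(w), with zero mean over a period, plus the
     derivative term less the error [eps]. *)
  set (g y := exp (- a) * (cos y * fst (f w) + sin y * snd (f w)) + (fst l - eps)).
  assert (Hg : is_RInt g 0 (2 * PI) (2 * PI * (fst l - eps))).
  { evar_last.
    apply (is_RInt_derive
      (fun y => exp (- a) * (sin y * fst (f w) - cos y * snd (f w)) + (fst l - eps) * y)).
    - intros y _. unfold g. auto_derive; [easy | ring].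
    - intros y _. apply (ex_derive_continuous g). unfold g. auto_derive. easy.
    - unfold minus, plus, opp; simpl. rewrite cos_2PI, sin_2PI, cos_0, sin_0. ring. }
  rewrite <- (is_RInt_unique _ _ _ _ Hg).
  apply RInt_le; [lra | eexists; exact Hg | now apply ex_RInt_logU | ].
  intros y _. unfold g, logU.
  assert (D := log_pt_dist w a y).
  specialize (K (log_pt w a y)). rewrite D in K. specialize (K Hed).
  assert (M := rot_component_le (f (log_pt w a y) - f w - l * (log_pt w a y - w))%C y).
  set (fz := f (log_pt w a y)) in *.
  (* Rotating l exp(a + i y) by exp(- i y) leaves l exp a, whose real part is exp a * fst l. *)
  assert (E : cos y * fst (fz - f w - l * (log_pt w a y - w))%C
              + sin y * snd (fz - f w - l * (log_pt w a y - w))%C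
            = cos y * fst fz + sin y * snd fz - (cos y * fst (f w) + sin y * snd (f w))
              - exp a * fst l).
  { unfold log_pt. simpl.
    assert (S := sin2_cos2 y). unfold Rsqr in S.
    replace (exp a * fst l) with (exp a * fst l * (sin y * sin y + cos y * cos y))
      by (rewrite S; ring).
    ring. }
  rewrite E in M. clear E.
  apply Rabs_le_between in M.
  assert (Hinv : exp (- a) * exp a = 1) by (rewrite <- exp_plus, Rplus_opp_l; apply exp_0).
  assert (P := exp_pos (- a)).
  set (A := cos y * fst fz + sin y * snd fz) in *.
  set (A0 := cos y * fst (f w) + sin y * snd (f w)) in *.
  assert (exp a * (fst l - eps) <= A - A0) by lra.
  apply (Rmult_le_compat_l (exp (- a))) in H; [ | lra].
  rewrite <- Rmult_assoc, Hinv in H. lra.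
Qed.

(** The common value of the means is almost at least 2 PI [fst l] far to the left and at most 2 PI
    exp(- b) at [b]. Letting [b] tend to [B] gives the estimate, without values of [f] on the unit
    circle. *)
Lemma cauchy_estimate_fst : fst l * (1 - Cmod w) <= 1.
Proof.
  assert (Hpi := PI_RGT_0).
  assert (Hr : 0 < 1 - Cmod w) by (unfold inD in w_inD; lra).
  assert (H : forall b, b < B -> fst l <= exp (- b)).
  { intros b Hb. apply le_epsilon. intros eps Heps.
    destruct (logU_mean_ge eps Heps) as [X HX].
    set (a := Rmin X b - 1).
    assert (A1 := Rmin_l X b). assert (A2 := Rmin_r X b).
    specialize (HX a ltac:(unfold a; lra) ltac:(unfold a; lra)).
    rewrite <- (logU_mean_constant a b) in HX by (unfold a; lra).
    assert (L := logU_mean_le b Hb).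
    assert (fst l - eps <= exp (- b)); [ | lra].
    apply Rmult_le_reg_l with (2 * PI); lra. }
  assert (HB : exp B = 1 - Cmod w) by (apply exp_ln; easy).
  apply le_epsilon. intros eps Heps.
  (* Chosen so that exp(- b) = (1 + eps) / (1 - |w|). *)
  set (b := B - ln (1 + eps)).
  assert (Hln : 0 < ln (1 + eps)) by (rewrite <- ln_1; apply ln_increasing; lra).
  specialize (H b ltac:(unfold b; lra)).
  replace (- b) with (ln (1 + eps) + - B) in H by (unfold b; ring).
  rewrite exp_plus, exp_ln, exp_Ropp, HB in H by lra.
  apply (Rmult_le_compat_r (1 - Cmod w)) in H; [ | lra].
  replace ((1 + eps) * / (1 - Cmod w) * (1 - Cmod w)) with (1 + eps) in H by (field; lra).
  easy.
Qed.

End Cauchy.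

Lemma cauchy_estimate f w l :
  (forall z, inD z -> exists l, has_Cderiv f z l) ->
  (forall z, inD z -> Cmod (f z) <= 1) ->
  inD w -> has_Cderiv f w l -> Cmod l <= / (1 - Cmod w).
Proof.
  intros Hf Hb Hw Hl.
  destruct (Cmod_rotation l) as (k & Hk & E).
  assert (K : fst (k * l)%C * (1 - Cmod w) <= 1).
  { apply (cauchy_estimate_fst (fun z => k * f z)%C); auto.
    - intros z Hz. destruct (Hf z Hz) as [l' Hl'].
      exists (k * l')%C. now apply has_Cderiv_scal.
    - intros z Hz. rewrite Cmod_mult, Hk, Rmult_1_l. auto.
    - now apply has_Cderiv_scal. }
  rewrite E in K. simpl in K.
  unfold inD in Hw.
  apply Rmult_le_reg_r with (1 - Cmod w); [lra | ].
  rewrite Rinv_l by lra. easy.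
Qed.

(** * The upper bound *)

Lemma has_Cderiv_kernel f z l : inD z -> has_Cderiv f z l ->
  has_Cderiv (fun w => f w / (1 - w))%C z (l / (1 - z) + f z / ((1 - z) * (1 - z)))%C.
Proof.
  intros Hz H eps Heps. unfold inD in Hz.
  set (m := Cmod (1 - z)).
  assert (Hm : 0 < m).
  { apply Cmod_gt_0. intros E. assert (E' : z = 1%C) by (replace z with (1 - (1 - z))%C by ring; rewrite E; ring).
    rewrite E', Cmod_1 in Hz. lra. }
  (* [K] bounds the coefficients of the quadratic terms in the remainder once |1 - w| >= m / 2. *)
  set (K := Cmod (f z) * (2 / m ^ 3) + Cmod l * (2 / m ^ 2)).
  assert (HK : 0 <= K).
  { assert (A1 := Cmod_ge_0 (f z)). assert (A2 := Cmod_ge_0 l).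
    unfold K. apply Rplus_le_le_0_compat; apply Rmult_le_pos; auto;
    apply Rlt_le, Rdiv_lt_0_compat; try lra; apply pow_lt; lra. }
  destruct (H (eps * m / 4)) as (d & Hd & Hf); [nra | ].
  (* The three radii serve the remainder of [f], the bound |1 - w| >= m / 2, and the quadratic
     terms; K + 1 avoids a division by zero when K = 0. *)
  exists (Rmin (Rmin d (m / 2)) (eps / 2 / (K + 1))).
  assert (Hq : 0 < eps / 2 / (K + 1)) by (apply Rdiv_lt_0_compat; lra).
  split. { repeat apply Rmin_glb_lt; lra. }
  intros w Hw.
  assert (W1 : Cmod (w - z) < d) by (eapply Rlt_le_trans; [exact Hw | ]; eapply Rle_trans; apply Rmin_l).
  assert (W2 : Cmod (w - z) < m / 2)
    by (eapply Rlt_le_trans; [exact Hw | ]; eapply Rle_trans; [apply Rmin_l | apply Rmin_r]).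
  assert (W3 : Cmod (w - z) < eps / 2 / (K + 1))
    by (eapply Rlt_le_trans; [exact Hw | ]; apply Rmin_r).
  specialize (Hf w W1).
  set (h := (w - z)%C) in *.
  assert (Hh := Cmod_ge_0 h).
  assert (Hw1 : m / 2 <= Cmod (1 - w)).
  { assert (T := Cmod_triangle (1 - w) h).
    replace (1 - w + h)%C with (1 - z)%C in T by (unfold h; ring). fold m in T. lra. }
  assert (N1 : (1 - w)%C <> 0%C) by (apply Cmod_gt_0; lra).
  assert (N2 : (1 - z)%C <> 0%C) by (apply Cmod_gt_0; exact Hm).
  (* The remainder of the quotient is that of [f] divided by 1 - w, plus two terms quadratic in
     [h]. *)
  assert (E : (f w / (1 - w) - f z / (1 - z) - (l / (1 - z) + f z / ((1 - z) * (1 - z))) * h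
     = (f w - f z - l * h) / (1 - w)
       + (f z * (h * h) / ((1 - z) * (1 - z) * (1 - w)) + l * (h * h) / ((1 - z) * (1 - w))))%C).
  { unfold h. field. auto. }
  rewrite E.
  assert (N3 : ((1 - z) * (1 - z) * (1 - w))%C <> 0%C) by (repeat apply Cmult_neq_0; auto).
  assert (N4 : ((1 - z) * (1 - w))%C <> 0%C) by (repeat apply Cmult_neq_0; auto).
  eapply Rle_trans; [apply Cmod_triangle | ].
  eapply Rle_trans; [apply Rplus_le_compat_l, Cmod_triangle | ].
  rewrite !Cmod_div, !Cmod_mult by auto. fold m.
  set (x := Cmod h) in *. set (q := Cmod (1 - w)) in *.
  assert (Hinv : / q <= 2 / m).
  { replace (2 / m) with (/ (m / 2)) by (field; lra). apply Rinv_le_contravar; lra. }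
  assert (Hq0 : 0 < / q) by (apply Rinv_0_lt_compat; lra).
  assert (B1 : Cmod (f w - f z - l * h) / q <= eps / 2 * x).
  { apply Rle_trans with (eps * m / 4 * x * (2 / m)).
    - unfold Rdiv at 1. apply Rmult_le_compat; auto; try lra. apply Cmod_ge_0.
    - apply Req_le. field. lra. }
  assert (B2 : Cmod (f z) * (x * x) / (m * m * q) <= Cmod (f z) * (2 / m ^ 3) * (x * x)).
  { replace (Cmod (f z) * (x * x) / (m * m * q)) with (Cmod (f z) * (x * x) / (m * m) * / q)
      by (field; lra).
    replace (Cmod (f z) * (2 / m ^ 3) * (x * x)) with (Cmod (f z) * (x * x) / (m * m) * (2 / m))
      by (field; lra).
    apply Rmult_le_compat_l; auto.
    apply Rdiv_le_0_compat; [ | nra]. apply Rmult_le_pos; [apply Cmod_ge_0 | nra]. }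
  assert (B3 : Cmod l * (x * x) / (m * q) <= Cmod l * (2 / m ^ 2) * (x * x)).
  { replace (Cmod l * (x * x) / (m * q)) with (Cmod l * (x * x) / m * / q)
      by (field; lra).
    replace (Cmod l * (2 / m ^ 2) * (x * x)) with (Cmod l * (x * x) / m * (2 / m))
      by (field; lra).
    apply Rmult_le_compat_l; auto.
    apply Rdiv_le_0_compat; [ | lra]. apply Rmult_le_pos; [apply Cmod_ge_0 | nra]. }
  assert (B4 : K * (x * x) <= eps / 2 * x).
  { apply Rle_trans with ((K + 1) * x * x); [nra | ].
    apply Rmult_le_compat_r; [easy | ].
    apply Rle_trans with ((K + 1) * (eps / 2 / (K + 1))); [apply Rmult_le_compat_l; lra | ].
    apply Req_le. field. lra. }
  unfold K in B4. lra.
Qed.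

Lemma one_minus_Cmod z : 1 - Cmod z <= Cmod (1 - z).
Proof.
  assert (T := Cmod_triangle (1 - z) z).
  replace (1 - z + z)%C with (RtoC 1) in T by ring. rewrite Cmod_1 in T. lra.
Qed.

Lemma one_minus_neq0 z : inD z -> (1 - z)%C <> 0%C.
Proof. intros H. apply Cmod_gt_0. unfold inD in H. generalize (one_minus_Cmod z). lra. Qed.

Lemma is_derive_ray (G : C -> C) (z L : C) (t : R) :
  has_Cderiv G (RtoC t * z)%C L ->
  is_derive (fun s => fst (G (RtoC s * z)%C)) t (fst (L * z)%C).
Proof.
  intros H. replace (RtoC t * z)%C with ((t * fst z, t * snd z) : C) in H
    by (unfold Cmult, RtoC; simpl; f_equal; ring).
  destruct (has_Cderiv_differentiable _ _ _ _ H) as [H1 _].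
  apply (is_derive_ext (fun s => fst (G (s * fst z, s * snd z)))).
  { intros s. f_equal. f_equal. unfold Cmult, RtoC; simpl. f_equal; ring. }
  apply is_derive_Reals.
  replace (fst (L * z)%C) with (fst L * fst z + - snd L * snd z) by (simpl; ring).
  apply (derivable_pt_lim_comp_2d (fun u v => fst (G (u, v))) (fun s => s * fst z) (fun s => s * snd z)).
  - exact H1.
  - apply is_derive_Reals. auto_derive; [easy | ring].
  - apply is_derive_Reals. auto_derive; [easy | ring].
Qed.

Lemma Cmod_ray t z : 0 <= t -> Cmod (RtoC t * z) = t * Cmod z.
Proof. intros H. now rewrite Cmod_mult, Cmod_R, Rabs_pos_eq. Qed.

Lemma ex_RInt_kernel r : 0 < r < 1 ->
  ex_RInt (fun t => / (1 - t * r)) 0 1.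
Proof.
  intros Hr. apply (ex_RInt_continuous (fun t => / (1 - t * r))). intros t.
  rewrite Rmin_left, Rmax_right by lra. intros Ht.
  apply (ex_derive_continuous (fun t => / (1 - t * r))). auto_derive. nra.
Qed.

(** The first four terms of the geometric series are integrated, so that the value - ln(1 - r) / r
    never enters. *)
Lemma kernel_RInt_ge r : 0 < r < 1 ->
  1 + r / 2 + r ^ 2 / 3 + r ^ 3 / 4 <= RInt (fun t => / (1 - t * r)) 0 1.
Proof.
  intros Hr.
  assert (H : is_RInt (fun t => 1 + t * r + t ^ 2 * r ^ 2 + t ^ 3 * r ^ 3) 0 1
                (1 + r / 2 + r ^ 2 / 3 + r ^ 3 / 4)).
  { evar_last.
    apply (is_RInt_derive (fun t => t + t ^ 2 * r / 2 + t ^ 3 * r ^ 2 / 3 + t ^ 4 * r ^ 3 / 4)).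
    - intros t _. auto_derive; [easy | field].
    - intros t _. apply (ex_derive_continuous (fun t => 1 + t * r + t ^ 2 * r ^ 2 + t ^ 3 * r ^ 3)).
      auto_derive. easy.
    - unfold minus, plus, opp; simpl. field. }
  rewrite <- (is_RInt_unique _ _ _ _ H).
  apply RInt_le; [lra | eexists; exact H | now apply ex_RInt_kernel | ].
  intros t Ht. set (x := t * r).
  assert (Hx : 0 < x < 1) by (unfold x; nra).
  replace (t ^ 2 * r ^ 2) with (x ^ 2) by (unfold x; ring).
  replace (t ^ 3 * r ^ 3) with (x ^ 3) by (unfold x; ring).
  apply Rmult_le_reg_r with (1 - x); [lra | ]. rewrite Rinv_l by lra.
  assert (0 < x ^ 4) by (apply pow_lt; lra). nra.
Qed.

Lemma bloch_arith r m J : 0 < r < 1 -> 0 <= m ->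
  1 + r / 2 + r ^ 2 / 3 + r ^ 3 / 4 <= J ->
  r * m <= / (1 - r) + J -> r * m <= 2 * / (1 - r) - 2 * J ->
  (1 - r ^ 2) * m <= 3.
Proof.
  intros Hr Hm HJ H1 H2.
  assert (Hi : (1 - r) * / (1 - r) = 1) by (field; lra).
  destruct (Rle_dec (4 / 5) r) as [L | L].
  (* Twice the first estimate plus the second cancels [J] and gives r m (1 - r) <= 4/3. Hence (1 -
     r^2) m <= (4/3) (1 + 1 / r), which equals 3 exactly at r = 4/5. *)
  - assert (H : r * m * (1 - r) <= 4 / 3).
    { apply Rle_trans with (4 / 3 * / (1 - r) * (1 - r)); [ | rewrite Rmult_assoc, Rinv_l; lra].
      apply Rmult_le_compat_r; lra. }
    apply Rmult_le_reg_l with r; [lra | ]. nra.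
  - assert (H : r * m * (1 - r) <= 2 - 2 * (1 - r) * J).
    { apply (Rmult_le_compat_r (1 - r)) in H2; [ | lra]. nra. }
    assert (HJ' : (1 - r) * (1 + r / 2 + r ^ 2 / 3 + r ^ 3 / 4) <= (1 - r) * J)
      by (apply Rmult_le_compat_l; lra).
    assert (Hp : r * ((1 - r ^ 2) * m)
              <= (1 + r) * (2 - 2 * ((1 - r) * (1 + r / 2 + r ^ 2 / 3 + r ^ 3 / 4)))).
    { replace (r * ((1 - r ^ 2) * m)) with ((1 + r) * (r * m * (1 - r))) by ring.
      apply Rmult_le_compat_l; lra. }
    apply Rmult_le_reg_l with r; [lra | ].
    eapply Rle_trans; [exact Hp | ].
    (* The bound vanishes at r = 0, so a factor r can be cancelled. The remaining polynomial is
       increasing and at r = 4/5 is about 2.93. *)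
    replace ((1 + r) * (2 - 2 * ((1 - r) * (1 + r / 2 + r ^ 2 / 3 + r ^ 3 / 4))))
      with (r * (1 + 4 / 3 * r + r ^ 2 / 2 + 2 / 3 * r ^ 3 + r ^ 4 / 2)) by field.
    apply Rmult_le_compat_l; [lra | ].
    assert (r ^ 2 <= (4 / 5) ^ 2) by (apply pow_incr; lra).
    assert (r ^ 3 <= (4 / 5) ^ 3) by (apply pow_incr; lra).
    assert (r ^ 4 <= (4 / 5) ^ 4) by (apply pow_incr; lra).
    lra.
Qed.

(** The real part of k g(t z), where g(w) = f(w) / (1 - w); the unit factor [k] is supplied by
    [Cmod_rotation]. *)
Definition ray (f : C -> C) (k z : C) (t : R) : R :=
  fst (k * (f (RtoC t * z) / (1 - RtoC t * z)))%C.

(** * Radial estimates for the Cesaro transform *)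

Section Upper.

Variable f : C -> C.
Hypothesis f_holo : forall z, inD z -> exists l, has_Cderiv f z l.
Hypothesis f_bound : forall z, inD z -> Cmod (f z) <= 1.

Lemma kernel_bound z : inD z -> Cmod (f z / (1 - z)) <= / (1 - Cmod z).
Proof.
  intros Hz. assert (N := one_minus_neq0 z Hz). assert (M := one_minus_Cmod z).
  rewrite Cmod_div by easy. unfold inD in Hz.
  rewrite <- (Rmult_1_l (/ (1 - Cmod z))). unfold Rdiv.
  apply Rmult_le_compat; auto using Cmod_ge_0.
  - apply Rlt_le, Rinv_0_lt_compat. lra.
  - apply Rinv_le_contravar; lra.
Qed.

(** The derivative of g(z) = f(z) / (1 - z) is (l + g(z)) / (1 - z), and both |l| and |g(z)| are at
    most 1 / (1 - |z|). *)
Lemma kernel_deriv_bound z l : inD z -> has_Cderiv f z l ->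
  Cmod (l / (1 - z) + f z / ((1 - z) * (1 - z))) <= 2 / (1 - Cmod z) ^ 2.
Proof.
  intros Hz Hl. assert (N := one_minus_neq0 z Hz). assert (M := one_minus_Cmod z).
  assert (E := cauchy_estimate f z l f_holo f_bound Hz Hl).
  assert (E' := kernel_bound z Hz).
  replace (l / (1 - z) + f z / ((1 - z) * (1 - z)))%C
    with ((l + f z / (1 - z)) / (1 - z))%C by (field; easy).
  rewrite Cmod_div by easy. unfold inD in Hz.
  replace (2 / (1 - Cmod z) ^ 2) with (2 * / (1 - Cmod z) * / (1 - Cmod z)) by (field; lra).
  unfold Rdiv. apply Rmult_le_compat.
  - apply Cmod_ge_0.
  - apply Rlt_le, Rinv_0_lt_compat. lra.
  - eapply Rle_trans; [apply Cmod_triangle | lra].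
  - apply Rinv_le_contravar; lra.
Qed.

Lemma ray_is_derive k z t : Cmod k = 1 -> 0 <= t -> t * Cmod z < 1 ->
  exists d, is_derive (ray f k z) t d /\ d <= 2 * Cmod z / (1 - t * Cmod z) ^ 2.
Proof.
  intros Hk Ht Hz.
  assert (HD : inD (RtoC t * z)%C) by (unfold inD; now rewrite Cmod_ray).
  destruct (f_holo _ HD) as [l Hl].
  set (L := (l / (1 - RtoC t * z)
    + f (RtoC t * z) / ((1 - RtoC t * z) * (1 - RtoC t * z)))%C).
  exists (fst (k * L * z)%C). split.
  - apply (is_derive_ray (fun w => k * (f w / (1 - w)))%C).
    apply has_Cderiv_scal; [easy | ]. now apply has_Cderiv_kernel.
  - eapply Rle_trans; [apply Rle_abs | ]. eapply Rle_trans; [apply fst_le_Cmod | ].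
    rewrite !Cmod_mult, Hk, Rmult_1_l.
    assert (B := kernel_deriv_bound _ _ HD Hl). fold L in B. rewrite Cmod_ray in B by easy.
    replace (2 * Cmod z / (1 - t * Cmod z) ^ 2)
      with (2 / (1 - t * Cmod z) ^ 2 * Cmod z) by (field; lra).
    apply Rmult_le_compat_r; [apply Cmod_ge_0 | easy].
Qed.

Lemma ray_continuous k z t : Cmod k = 1 -> 0 <= t -> t * Cmod z < 1 ->
  continuous (ray f k z) t.
Proof.
  intros Hk Ht Hz. destruct (ray_is_derive k z t Hk Ht Hz) as (d & Hd & _).
  apply (ex_derive_continuous (ray f k z)). now exists d.
Qed.

Lemma ray_ex_RInt k z s : Cmod k = 1 -> 0 <= s -> s * Cmod z < 1 ->
  ex_RInt (ray f k z) 0 s.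
Proof.
  intros Hk Hs Hz. apply (ex_RInt_continuous (ray f k z)). intros t.
  rewrite Rmin_left, Rmax_right by lra. intros Ht.
  assert (H := Cmod_ge_0 z).
  apply ray_continuous; auto; [lra | nra].
Qed.

(** By [ray_is_derive], subtracting 2 / (1 - t |z|) from the ray leaves a function with nonpositive
    derivative. The mean value theorem is used because integrability of the derivative of [ray] has
    not been established. *)
Lemma ray_increment k z a b : Cmod k = 1 -> 0 <= a <= b -> b * Cmod z < 1 ->
  ray f k z b - ray f k z a <= 2 * / (1 - b * Cmod z) - 2 * / (1 - a * Cmod z).
Proof.
  intros Hk Hab Hz.
  assert (H0 := Cmod_ge_0 z).
  set (v t := ray f k z t - 2 * / (1 - t * Cmod z)).
  assert (Hv : forall t, 0 <= t -> t * Cmod z < 1 -> exists d, is_derive v t d /\ d <= 0).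
  { intros t Ht Htz. destruct (ray_is_derive k z t Hk Ht Htz) as (d & Hd & Hle).
    exists (d - 2 * Cmod z / (1 - t * Cmod z) ^ 2). split; [ | lra].
    apply (is_derive_minus (ray f k z) (fun t => 2 * / (1 - t * Cmod z))); [easy | ].
    auto_derive; [lra | field; lra]. }
  assert (HD : forall t, 0 <= t -> t * Cmod z < 1 -> is_derive v t (Derive v t) /\ Derive v t <= 0).
  { intros t Ht Htz. destruct (Hv t Ht Htz) as (d & Hd & Hle).
    rewrite (is_derive_unique _ _ _ Hd). easy. }
  destruct (MVT_gen v a b (Derive v)) as (c & Hc & E).
  - intros t. rewrite Rmin_left, Rmax_right by lra. intros Ht. apply HD; [lra | nra].
  - intros t. rewrite Rmin_left, Rmax_right by lra. intros Ht.
    apply continuity_pt_filterlim. apply (ex_derive_continuous v).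
    exists (Derive v t). apply HD; [lra | nra].
  - rewrite Rmin_left, Rmax_right in Hc by lra.
    destruct (HD c ltac:(lra) ltac:(nra)) as [_ L]. unfold v in E at 1 2. nra.
Qed.

Lemma cesaro_ray k z : Cmod k = 1 -> inD z ->
  fst (k * cesaro f z)%C = RInt (ray f k z) 0 1.
Proof.
  intros Hk Hz. unfold inD in Hz.
  assert (H1 : ex_RInt (fun t => fst (f (RtoC t * z) / (1 - RtoC t * z))%C) 0 1).
  { eapply ex_RInt_ext; [ | apply (ray_ex_RInt 1 z 1); [apply Cmod_1 | lra | lra]].
    intros t _. unfold ray. now rewrite Cmult_1_l. }
  assert (H2 : ex_RInt (fun t => snd (f (RtoC t * z) / (1 - RtoC t * z))%C) 0 1).
  (* For k = - i the real part of k q is the imaginary part of q. *)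
  { eapply ex_RInt_ext; [ | apply (ray_ex_RInt (- Ci) z 1); [ | lra | lra]].
    - intros t _. unfold ray.
      set (q := (f (RtoC t * z) / (1 - RtoC t * z))%C). simpl. ring.
    - rewrite Cmod_opp. apply Cmod_Ci. }
  assert (M := RInt_minus (V := R_CompleteNormedModule) _ _ 0 1
    (ex_RInt_scal _ 0 1 (fst k) H1) (ex_RInt_scal _ 0 1 (snd k) H2)).
  assert (M1 := RInt_scal (V := R_CompleteNormedModule) _ 0 1 (fst k) H1).
  assert (M2 := RInt_scal (V := R_CompleteNormedModule) _ 0 1 (snd k) H2).
  symmetry. exact (eq_trans M (f_equal2 minus M1 M2)).
Qed.

Lemma cesaro_ray_scaled k z s : Cmod k = 1 -> 0 <= s -> s * Cmod z < 1 ->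
  s * fst (k * cesaro f (RtoC s * z))%C = RInt (ray f k z) 0 s.
Proof.
  intros Hk Hs Hz.
  rewrite cesaro_ray by (auto; unfold inD; rewrite Cmod_ray; easy).
  assert (E := RInt_comp_lin (ray f k z) s 0 0 1).
  rewrite Rmult_0_r, Rmult_1_r, !Rplus_0_r in E.
  rewrite <- E by now apply ray_ex_RInt.
  assert (X : ex_RInt (ray f k (RtoC s * z)) 0 1).
  { apply ray_ex_RInt; [easy | lra | ]. rewrite Cmod_ray by easy. lra. }
  transitivity (RInt (fun t => scal s (ray f k (RtoC s * z) t)) 0 1).
  - symmetry. exact (RInt_scal _ 0 1 s X).
  - apply RInt_ext. intros t _. unfold ray. f_equal. f_equal.
    replace (RtoC (s * t + 0)) with (RtoC t * RtoC s)%C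
      by (rewrite <- RtoC_mult; f_equal; ring).
    now rewrite Cmult_assoc.
Qed.

(* Differentiating [s * cesaro f (s z) = \int_0^s f (t z) / (1 - t z) dt] at [s = 1]. *)
Lemma cesaro_deriv_ray k z l : Cmod k = 1 -> inD z -> has_Cderiv (cesaro f) z l ->
  fst (k * (l * z))%C = ray f k z 1 - RInt (ray f k z) 0 1.
Proof.
  intros Hk Hz Hl. assert (Hz' := Hz). unfold inD in Hz'. assert (H0 := Cmod_ge_0 z).
  assert (E1 : (RtoC 1 * z)%C = z) by ring.
  set (phi s := s * fst (k * cesaro f (RtoC s * z))%C).
  assert (D1 : is_derive phi 1 (1 * fst (k * cesaro f (RtoC 1 * z))%C + 1 * fst (k * l * z)%C)).
  { apply (is_derive_mult (fun s => s) (fun s => fst (k * cesaro f (RtoC s * z))%C)).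
    - apply (is_derive_id (K := R_AbsRing) 1).
    - apply (is_derive_ray (fun w => k * cesaro f w)%C).
      apply has_Cderiv_scal; [easy | ]. now rewrite E1.
    - intros. apply Rmult_comm. }
  assert (D2 : is_derive phi 1 (ray f k z 1)).
  { apply (is_derive_RInt (ray f k z) phi 0 1).
    (* If |s - 1| < 1 - |z|, then s > 0 and s |z| <= (2 - |z|) |z| = 1 - (1 - |z|)^2 < 1, so the ray
       is integrable slightly past its end point. *)
    - assert (Hr : 0 < 1 - Cmod z) by lra.
      exists (mkposreal _ Hr). intros s Hs.
      apply Rabs_lt_between in Hs. unfold minus, plus, opp in Hs; simpl in Hs.
      assert (s * Cmod z < 1) by nra.
      unfold phi. rewrite cesaro_ray_scaled by (auto; lra).
      apply (RInt_correct (V := R_CompleteNormedModule)), ray_ex_RInt; auto; lra.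
    - apply ray_continuous; auto; lra. }
  assert (E := is_derive_unique _ _ _ D1). rewrite (is_derive_unique _ _ _ D2), E1 in E.
  rewrite cesaro_ray in E by easy.
  rewrite Cmult_assoc. lra.
Qed.

(** At z = 0 the identity for z F'(z) says nothing about F'(0). Instead a rotated real part of F is
    followed from 0 towards 1/2, where its slope is |l| / 2, and its difference quotients are
    bounded by 6/5. *)
Lemma cesaro_deriv_0 l : has_Cderiv (cesaro f) 0%C l -> Cmod l <= 3.
Proof.
  intros Hl.
  destruct (Cmod_rotation l) as (k & Hk & E).
  set (z := RtoC (1 / 2)).
  assert (Hz : Cmod z = 1 / 2) by (unfold z; rewrite Cmod_R, Rabs_pos_eq; lra).
  set (phi s := fst (k * cesaro f (RtoC s * z))%C).
  assert (D : is_derive phi 0 (Cmod l / 2)).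
  { replace (Cmod l / 2) with (fst (k * l * z)%C)
      by (rewrite E; unfold z; simpl; field).
    apply (is_derive_ray (fun w => k * cesaro f w)%C).
    apply has_Cderiv_scal; [easy | ]. replace (RtoC 0 * z)%C with (RtoC 0) by ring. easy. }
  (* The inequality 1 / (1 - t / 2) <= 1 + 3 t / 5 holds precisely up to t = 1/3 for t > 0; with
     [ray_increment] it gives the slope 6/5. *)
  assert (Hphi : forall s, 0 < s < 1 / 3 -> phi s - phi 0 <= 6 / 5 * s).
  { intros s Hs.
    assert (S1 : s * phi s = RInt (ray f k z) 0 s)
      by (apply cesaro_ray_scaled; auto; rewrite ?Hz; lra).
    assert (S0 : phi 0 = ray f k z 0).
    { unfold phi. rewrite cesaro_ray; [ | easy | ].
      - rewrite (RInt_ext _ (fun _ => ray f k z 0)).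
        + rewrite RInt_const. unfold scal, mult; simpl; unfold mult; simpl. ring.
        + intros t _. unfold ray.
          now replace (RtoC t * (RtoC 0 * z))%C with (RtoC 0 * z)%C by ring.
      - unfold inD. rewrite Cmod_ray by lra. lra. }
    assert (RInt (ray f k z) 0 s <= RInt (fun _ => ray f k z 0 + 6 / 5 * s) 0 s).
    { apply RInt_le; [lra | apply ray_ex_RInt; auto; rewrite ?Hz; lra | apply ex_RInt_const | ].
      intros t Ht.
      assert (I := ray_increment k z 0 t Hk ltac:(lra) ltac:(rewrite Hz; lra)).
      rewrite Hz, Rmult_0_l, Rminus_0_r, Rinv_1 in I.
      assert (/ (1 - t * (1 / 2)) <= 1 + 3 / 5 * t); [ | lra].
      apply Rmult_le_reg_r with (1 - t * (1 / 2)); [lra | ]. rewrite Rinv_l by lra. nra. }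
    rewrite RInt_const in H. unfold scal, mult in H; simpl in H; unfold mult in H; simpl in H.
    rewrite <- S1, <- S0, Rminus_0_r in H. apply Rmult_le_reg_l in H; lra. }
  apply Rnot_lt_le. intros N.
  apply is_derive_Reals in D.
  (* If |l| > 3, the slope exceeds 3/2, and a tolerance of 1/10 still leaves the difference quotient
     above 6/5. *)
  destruct (D (1 / 10) ltac:(lra)) as [d Hd].
  set (s := Rmin (d / 2) (1 / 4)).
  assert (Hs : 0 < s) by (apply Rmin_glb_lt; [assert (X := cond_pos d); lra | lra]).
  assert (A1 := Rmin_l (d / 2) (1 / 4)). assert (A2 := Rmin_r (d / 2) (1 / 4)). fold s in A1, A2.
  assert (X := cond_pos d).
  specialize (Hd s ltac:(lra) ltac:(rewrite Rabs_pos_eq; lra)).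
  rewrite Rplus_0_l in Hd. apply Rabs_lt_between in Hd.
  specialize (Hphi s ltac:(lra)).
  assert ((phi s - phi 0) / s <= 6 / 5); [ | lra].
  apply Rmult_le_reg_r with s; [lra | ]. unfold Rdiv at 1. rewrite Rmult_assoc, Rinv_l; lra.
Qed.

Lemma cesaro_bloch_bound z l : inD z -> has_Cderiv (cesaro f) z l ->
  (1 - Cmod z ^ 2) * Cmod l <= 3.
Proof.
  intros Hz Hl. assert (H0 := Cmod_ge_0 z).
  destruct H0 as [H0 | H0].
  2:{ symmetry in H0. rewrite H0. apply Cmod_eq_0 in H0. subst z.
      assert (X := cesaro_deriv_0 l Hl). lra. }
  assert (Hz' := Hz). unfold inD in Hz'.
  destruct (Cmod_rotation (l * z)%C) as (k & Hk & E).
  assert (I := cesaro_deriv_ray k z l Hk Hz Hl). rewrite E in I. simpl in I.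
  rewrite Cmod_mult, Rmult_comm in I.
  set (r := Cmod z) in *.
  assert (X := ray_ex_RInt k z 1 Hk ltac:(lra) ltac:(fold r; lra)).
  assert (Y := ex_RInt_kernel r ltac:(lra)).
  apply bloch_arith with (RInt (fun t => / (1 - t * r)) 0 1); try lra.
  - apply Cmod_ge_0.
  - apply kernel_RInt_ge. lra.
  (* First estimate: the end value and the integral are bounded separately, using only |f| <= 1. *)
  - rewrite I.
    assert (B : forall t, 0 <= t <= 1 -> Rabs (ray f k z t) <= / (1 - t * r)).
    { intros t Ht. unfold ray. eapply Rle_trans; [apply fst_le_Cmod | ].
      rewrite Cmod_mult, Hk, Rmult_1_l. unfold r. rewrite <- Cmod_ray by lra.
      apply kernel_bound. unfold inD. rewrite Cmod_ray by lra. fold r. nra. }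
    assert (B1 := B 1 ltac:(lra)). rewrite Rmult_1_l in B1. apply Rabs_le_between in B1.
    assert (B2 : Rabs (RInt (ray f k z) 0 1) <= RInt (fun t => / (1 - t * r)) 0 1).
    { eapply Rle_trans; [apply abs_RInt_le; [lra | easy] | ].
      apply RInt_le; auto; [lra | | intros; apply B; lra].
      apply (ex_RInt_norm (ray f k z)). easy. }
    apply Rabs_le_between in B2. lra.
  (* Second estimate: the increment bound from t to 1 is integrated over t, which keeps the
     cancellation between end value and mean. *)
  - rewrite I.
    assert (RInt (fun t => minus (ray f k z 1 - 2 * / (1 - r)) (ray f k z t)) 0 1
            <= RInt (fun t => scal (- 2) (/ (1 - t * r))) 0 1).
    { apply RInt_le; [lra | | | ].
      - apply (ex_RInt_minus (fun _ => ray f k z 1 - 2 * / (1 - r)) (ray f k z));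
          [apply ex_RInt_const | easy].
      - apply (ex_RInt_scal (V := R_NormedModule)). easy.
      - intros t Ht.
        assert (J := ray_increment k z t 1 Hk ltac:(lra) ltac:(fold r; lra)).
        fold r in J. rewrite Rmult_1_l in J.
        unfold minus, plus, opp, scal, mult; simpl; unfold mult; simpl. lra. }
    assert (M := RInt_minus (V := R_CompleteNormedModule) _ _ 0 1
      (ex_RInt_const 0 1 (ray f k z 1 - 2 * / (1 - r))) X).
    assert (M' := RInt_scal (V := R_CompleteNormedModule) _ 0 1 (- 2) Y).
    rewrite RInt_const in M.
    unfold minus, plus, opp, scal, mult in H, M, M'; simpl in H, M, M';
      unfold mult in H, M, M'; simpl in H, M, M'.
    lra.
Qed.

End Upper.

Lemma cesaro_at_0 f : (forall z, inD z -> exists l, has_Cderiv f z l) ->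
  (forall z, inD z -> Cmod (f z) <= 1) -> Cmod (cesaro f 0%C) <= 1.
Proof.
  intros Hf Hb.
  assert (H0 : inD 0%C) by (unfold inD; rewrite Cmod_0; lra).
  destruct (Cmod_rotation (cesaro f 0%C)) as (k & Hk & E).
  replace (Cmod (cesaro f 0%C)) with (fst (k * cesaro f 0%C)%C) by now rewrite E.
  rewrite (cesaro_ray f Hf Hb) by easy.
  eapply Rle_trans; [apply Rle_abs | ].
  replace 1 with ((1 - 0) * 1) at 2 by ring.
  apply abs_RInt_le_const; [lra | apply (ray_ex_RInt f Hf Hb); rewrite ?Cmod_0; auto; lra | ].
  intros t _. unfold ray. eapply Rle_trans; [apply fst_le_Cmod | ].
  rewrite Cmult_0_r, Cmod_mult, Hk, Rmult_1_l.
  eapply Rle_trans; [apply (kernel_bound f Hb); easy | ].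
  rewrite Cmod_0, Rminus_0_r, Rinv_1. lra.
Qed.

(** Reduces the weight for alpha >= 1 to the weight for alpha = 1, with c = 1 - |z|^2. *)
Lemma Rpower_le_base c alpha : 0 < c <= 1 -> 1 <= alpha -> Rpower c alpha <= c.
Proof.
  intros Hc Ha. rewrite <- (exp_ln c) at 2 by lra. unfold Rpower.
  assert (ln c <= 0).
  { rewrite <- ln_1. destruct (Req_dec c 1) as [-> | N]; [lra | ].
    apply Rlt_le, ln_increasing; lra. }
  assert (L : alpha * ln c <= ln c) by nra.
  destruct L as [L | ->]; [apply Rlt_le, exp_increasing, L | lra].
Qed.

Lemma cesaro_opnorm_le_4 alpha : 1 <= alpha ->
  Rbar_le (cesaro_opnorm alpha) (Finite 4).
Proof.
  intros Ha. apply Lub_Rbar_correct. intros r (f & Hf & Hb & Hr).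
  assert (f_holo : forall z, inD z -> exists l, has_Cderiv f z l).
  { intros z Hz. destruct (Hf z Hz) as [l Hl]. exists l. now apply is_derive_has_Cderiv. }
  assert (f_bound : forall z, inD z -> Cmod (f z) <= 1).
  { intros z Hz.
    assert (K : Rbar_le (Cmod (f z)) (Hinf_norm f))
      by (apply Lub_Rbar_correct; exists z; easy).
    exact (Rbar_le_trans _ _ _ K Hb). }
  apply (Rbar_le_trans _ _ _ Hr). unfold bloch_norm.
  (* The value at the origin contributes 1 and the seminorm 3. *)
  replace (Finite 4) with (Rbar_plus (Finite 1) (Finite 3)) by (simpl; f_equal; ring).
  apply Rbar_plus_le_compat.
  - now apply cesaro_at_0.
  - apply Lub_Rbar_correct. intros q (z & l & Hz & Hl & ->). simpl.
    apply is_derive_has_Cderiv in Hl.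
    eapply Rle_trans; [ | exact (cesaro_bloch_bound f f_holo f_bound z l Hz Hl)].
    apply Rmult_le_compat_r; [apply Cmod_ge_0 | ].
    unfold inD in Hz. assert (H0 := Cmod_ge_0 z).
    apply Rpower_le_base; [nra | easy].
Qed.

(** * The lower bound *)

Definition cesaro1_deriv (x : R) : R := RInt (fun t => t / (1 - t * x) ^ 2) 0 1.

Lemma const1_holo : forall z, inD z -> exists l, has_Cderiv (fun _ => 1%C) z l.
Proof.
  intros z _. exists 0%C. intros eps Heps. exists 1. split; [lra | ]. intros w _.
  replace (1 - 1 - 0 * (w - z))%C with (RtoC 0) by ring.
  rewrite Cmod_0. apply Rmult_le_pos; [lra | apply Cmod_ge_0].
Qed.

Lemma const1_bound : forall z, inD z -> Cmod 1 <= 1.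
Proof. intros z _. rewrite Cmod_1. lra. Qed.

Lemma ex_RInt_cesaro1_deriv x : 0 <= x < 1 -> ex_RInt (fun t => t / (1 - t * x) ^ 2) 0 1.
Proof.
  intros Hx. apply (ex_RInt_continuous (fun t => t / (1 - t * x) ^ 2)). intros t.
  rewrite Rmin_left, Rmax_right by lra. intros Ht.
  apply (ex_derive_continuous (fun t => t / (1 - t * x) ^ 2)). auto_derive.
  assert (0 < 1 - t * x) by nra. apply Rgt_not_eq. nra.
Qed.

(** Differentiation under the integral sign by an explicit remainder: that of 1 / (1 - t x) is t^2
    h^2 / ((1 - t x)^2 (1 - t w)). *)
Lemma cesaro1_has_Cderiv x : 0 <= x < 1 ->
  has_Cderiv (cesaro (fun _ => 1%C)) (RtoC x) (RtoC (cesaro1_deriv x)).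
Proof.
  intros Hx eps Heps.
  set (e := 1 - x). assert (He : 0 < e) by (unfold e; lra).
  (* With |1 - t x| >= e and |1 - t w| >= e / 2, the integrand's remainder is at most K |h|^2. *)
  set (K := 2 / e ^ 3).
  assert (HK : 0 < K) by (unfold K; apply Rdiv_lt_0_compat; [lra | apply pow_lt; lra]).
  exists (Rmin (e / 2) (eps / K)). split.
  { apply Rmin_glb_lt; [lra | now apply Rdiv_lt_0_compat]. }
  intros w Hw.
  assert (W1 : Cmod (w - x) < e / 2) by (eapply Rlt_le_trans; [exact Hw | apply Rmin_l]).
  assert (W2 : Cmod (w - x) < eps / K) by (eapply Rlt_le_trans; [exact Hw | apply Rmin_r]).
  set (h := (w - RtoC x)%C) in *.
  assert (Hxm : Cmod (RtoC x) = x) by (rewrite Cmod_R, Rabs_pos_eq; lra).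
  assert (Hwm : Cmod w < 1 - e / 2).
  { replace w with (RtoC x + h)%C by (unfold h; ring).
    eapply Rle_lt_trans; [apply Cmod_triangle | ]. rewrite Hxm. unfold e in *. lra. }
  assert (HDw : inD w) by (unfold inD; lra).
  assert (HDx : inD (RtoC x)) by (unfold inD; lra).
  match goal with |- Cmod ?X <= _ => destruct (Cmod_rotation X) as (k & Hk & E) end.
  match type of E with ?X = RtoC (Cmod ?Y) =>
    replace (Cmod Y) with (fst X) by now rewrite E end. clear E.
  replace (fst _) with
    (fst (k * cesaro (fun _ => 1%C) w)%C - fst (k * cesaro (fun _ => 1%C) (RtoC x))%C
     - fst (k * h)%C * cesaro1_deriv x).
  2:{ unfold Cmult, Cminus, Cplus, Copp, RtoC. simpl. ring. }
  rewrite !(cesaro_ray _ const1_holo const1_bound) by easy.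
  assert (I1 := ray_ex_RInt _ const1_holo const1_bound k w 1 Hk ltac:(lra) ltac:(lra)).
  assert (I2 := ray_ex_RInt _ const1_holo const1_bound k (RtoC x) 1 Hk ltac:(lra) ltac:(lra)).
  assert (I3 := ex_RInt_scal (V := R_NormedModule) _ 0 1 (fst (k * h)%C) (ex_RInt_cesaro1_deriv x Hx)).
  assert (I4 := ex_RInt_minus _ _ 0 1 I1 I2).
  assert (M1 := RInt_minus (V := R_CompleteNormedModule) _ _ 0 1 I4 I3).
  assert (M2 := RInt_minus (V := R_CompleteNormedModule) _ _ 0 1 I1 I2).
  assert (M3 := RInt_scal (V := R_CompleteNormedModule) _ 0 1 (fst (k * h)%C)
                  (ex_RInt_cesaro1_deriv x Hx)).
  assert (M := eq_trans M1 (f_equal2 minus M2 M3)).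
  eapply Rle_trans; [apply Req_le; symmetry; exact M | ].
  eapply Rle_trans; [apply Rle_abs | ].
  apply Rle_trans with ((1 - 0) * (K * (Cmod h * Cmod h))).
  - apply abs_RInt_le_const; [lra | exact (ex_RInt_minus _ _ 0 1 I4 I3) | ].
    intros t Ht.
    assert (Dtw : inD (RtoC t * w)%C).
    { unfold inD. rewrite Cmod_ray by lra. assert (X := Cmod_ge_0 w). nra. }
    assert (Dtx : inD (RtoC t * RtoC x)%C).
    { unfold inD. rewrite Cmod_ray, Hxm by lra. nra. }
    assert (N1 := one_minus_neq0 _ Dtw). assert (N2 := one_minus_neq0 _ Dtx).
    set (T := (k * (RtoC (t * t) * (h * h)
       / ((1 - RtoC t * RtoC x) * (1 - RtoC t * RtoC x) * (1 - RtoC t * w))))%C).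
    assert (Q : 0 < 1 - t * x) by nra.
    assert (ET : minus (minus (ray (fun _ => 1%C) k w t) (ray (fun _ => 1%C) k (RtoC x) t))
       (scal (fst (k * h)%C) (t / (1 - t * x) ^ 2)) = fst T).
    { transitivity (fst (k * (1 / (1 - RtoC t * w)) - k * (1 / (1 - RtoC t * RtoC x))
                          - RtoC (t / (1 - t * x) ^ 2) * (k * h))%C).
      - unfold ray, minus, plus, opp, scal, mult; simpl; unfold mult; simpl. ring.
      - f_equal. unfold T.
        replace (RtoC (t / (1 - t * x) ^ 2))
          with (RtoC t / ((1 - RtoC t * RtoC x) * (1 - RtoC t * RtoC x)))%C.
        + rewrite RtoC_mult. unfold h. field. auto.
        + rewrite <- RtoC_mult, <- RtoC_minus, <- RtoC_mult, <- RtoC_div by nra.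
          f_equal. field. lra. }
    eapply Rle_trans; [apply Req_le, f_equal, ET | ].
    eapply Rle_trans; [apply fst_le_Cmod | ]. unfold T.
    rewrite Cmod_mult, Hk, Rmult_1_l.
    rewrite Cmod_div by (repeat apply Cmult_neq_0; auto).
    rewrite !Cmod_mult.
    rewrite Cmod_R, (Rabs_pos_eq (t * t)) by nra.
    assert (L1 := one_minus_Cmod (RtoC t * w)). rewrite Cmod_ray in L1 by lra.
    assert (L2 := one_minus_Cmod (RtoC t * RtoC x)). rewrite Cmod_ray, Hxm in L2 by lra.
    set (q1 := Cmod (1 - RtoC t * w)) in *. set (q2 := Cmod (1 - RtoC t * RtoC x)) in *.
    assert (B1 : e / 2 <= q1) by (assert (X := Cmod_ge_0 w); nra).
    assert (B2 : e <= q2) by (unfold e; nra).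
    set (n := Cmod h * Cmod h).
    assert (Hn : 0 <= n) by (unfold n; assert (X := Cmod_ge_0 h); nra).
    assert (B3 : e ^ 3 / 2 <= q2 * q2 * q1).
    { apply Rle_trans with (e * e * (e / 2)); [apply Req_le; field | ].
      apply Rmult_le_compat; try nra. }
    assert (P3 : 0 < e ^ 3) by (apply pow_lt; lra).
    unfold Rdiv. rewrite (Rmult_comm K n).
    assert (B4 : t * t <= 1) by nra.
    apply Rmult_le_compat; try nra.
    + apply Rlt_le, Rinv_0_lt_compat. lra.
    + unfold K. replace (2 / e ^ 3) with (/ (e ^ 3 / 2)) by (field; lra).
      apply Rinv_le_contravar; lra.
  - assert (X := Cmod_ge_0 h).
    assert (K * Cmod h <= eps); [ | nra].
    apply Rle_trans with (K * (eps / K)); [apply Rmult_le_compat_l; lra | ].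
    apply Req_le. field. lra.
Qed.

(* AM-GM in the form [1 / u <= d / u ^ 2 + 1 / (4 d)] avoids evaluating the logarithmic integral. *)
Lemma cesaro1_deriv_ge x d : 0 <= x < 1 -> 0 < d ->
  (1 - d) / (1 - x) - / (4 * d) <= cesaro1_deriv x.
Proof.
  intros Hx Hd.
  assert (H : is_RInt (fun t => (1 - d) / (1 - t * x) ^ 2 - / (4 * d)) 0 1
                ((1 - d) / (1 - x) - / (4 * d))).
  { evar_last.
    apply (is_RInt_derive (fun t => (1 - d) * (t / (1 - t * x)) - t * / (4 * d))).
    - intros t. rewrite Rmin_left, Rmax_right by lra. intros Ht.
      assert (0 < 1 - t * x) by nra.
      auto_derive; [lra | field; lra].
    - intros t. rewrite Rmin_left, Rmax_right by lra. intros Ht.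
      assert (0 < 1 - t * x) by nra.
      apply (ex_derive_continuous (fun t => (1 - d) / (1 - t * x) ^ 2 - / (4 * d))).
      auto_derive. apply Rgt_not_eq. nra.
    - unfold minus, plus, opp; simpl. field; lra. }
  rewrite <- (is_RInt_unique _ _ _ _ H). unfold cesaro1_deriv.
  apply RInt_le; [lra | eexists; exact H | now apply ex_RInt_cesaro1_deriv | ].
  intros t Ht. assert (Hu : 0 < 1 - t * x) by nra.
  (* Since t >= t x = 1 - u, the integrand t / u^2 is at least 1 / u^2 - 1 / u. *)
  assert (Hxt : 1 - (1 - t * x) <= t) by nra.
  set (u := 1 - t * x) in *.
  apply Rmult_le_reg_r with (4 * d * u ^ 2); [apply Rmult_lt_0_compat; [lra | now apply pow_lt] | ].
  replace (((1 - d) / u ^ 2 - / (4 * d)) * (4 * d * u ^ 2)) with ((1 - d) * (4 * d) - u ^ 2)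
    by (field; lra).
  replace (t / u ^ 2 * (4 * d * u ^ 2)) with (t * (4 * d)) by (field; lra).
  assert (0 <= (u - 2 * d) ^ 2) by apply pow2_ge_0.
  nra.
Qed.

Lemma cesaro1_deriv_0 : cesaro1_deriv 0 = 1 / 2.
Proof.
  apply is_RInt_unique. evar_last.
  apply (is_RInt_derive (fun t => t ^ 2 / 2)).
  - intros t _. auto_derive; [easy | field].
  - intros t _. apply (ex_derive_continuous (fun t => t / (1 - t * 0) ^ 2)).
    auto_derive. lra.
  - unfold minus, plus, opp; simpl. field.
Qed.

Lemma cesaro1_0 : Cmod (cesaro (fun _ => 1%C) 0%C) = 1.
Proof.
  replace (cesaro (fun _ => 1%C) 0%C) with (RtoC 1); [apply Cmod_1 | ].
  unfold cesaro, cint01.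
  rewrite (RInt_ext _ (fun _ => 1)), (RInt_ext (fun t => snd _) (fun _ => 0)).
  - rewrite !RInt_const. unfold scal, mult; simpl; unfold mult; simpl.
    unfold RtoC. f_equal; ring.
  - intros t _. simpl. field.
  - intros t _. simpl. field.
Qed.

Lemma cesaro_opnorm_ge alpha x : 0 <= x < 1 ->
  Rbar_le (Finite (1 + Rpower (1 - x ^ 2) alpha * cesaro1_deriv x)) (cesaro_opnorm alpha).
Proof.
  intros Hx. apply Lub_Rbar_correct. exists (fun _ => 1%C). split; [ | split].
  - intros z Hz. destruct (const1_holo z Hz) as [l Hl].
    exists l. now apply is_derive_has_Cderiv.
  - apply Lub_Rbar_correct. intros r (z & _ & ->). rewrite Cmod_1. simpl. lra.
  - unfold bloch_norm. rewrite cesaro1_0.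
    change (Finite (1 + Rpower (1 - x ^ 2) alpha * cesaro1_deriv x))
      with (Rbar_plus (Finite 1) (Finite (Rpower (1 - x ^ 2) alpha * cesaro1_deriv x))).
    apply Rbar_plus_le_compat; [apply Rbar_le_refl | ].
    apply Lub_Rbar_correct. exists (RtoC x), (RtoC (cesaro1_deriv x)).
    assert (Hm : Cmod (RtoC x) = x) by (rewrite Cmod_R, Rabs_pos_eq; lra).
    split; [unfold inD; lra | split].
    + apply is_derive_has_Cderiv. now apply cesaro1_has_Cderiv.
    + rewrite Hm, Cmod_R, Rabs_pos_eq; [easy | ].
      apply RInt_ge_0; [lra | now apply ex_RInt_cesaro1_deriv | ].
      intros t Ht. assert (0 < 1 - t * x) by nra.
      apply Rlt_le, Rdiv_lt_0_compat; [lra | apply pow_lt; lra].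
Qed.

(** Needed because the test function yields 3 only in the limit x -> 1. *)
Lemma Rbar_le_of_lt (r : R) (B : Rbar) :
  (forall q : R, q < r -> Rbar_le (Finite q) B) -> Rbar_le (Finite r) B.
Proof.
  intros H. destruct B as [b | | ]; simpl in *; auto.
  - apply Rnot_lt_le. intros N. specialize (H ((b + r) / 2) ltac:(lra)). lra.
  - exact (H (r - 1) ltac:(lra)).
Qed.

Lemma cesaro_opnorm_1_ge_3 : Rbar_le (Finite 3) (cesaro_opnorm 1).
Proof.
  apply Rbar_le_of_lt. intros q Hq.
  set (d := Rmin (1 / 4) ((3 - q) / 8)).
  assert (Hd : 0 < d) by (apply Rmin_glb_lt; lra).
  assert (D1 := Rmin_l (1 / 4) ((3 - q) / 8)). assert (D2 := Rmin_r (1 / 4) ((3 - q) / 8)).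
  fold d in D1, D2.
  (* This relation makes 1 / (4 d) = d / (1 - x), the best choice of [d] for given [x]. The lower
     bound becomes (1 - 2 d) / (1 - x), and after weighting it tends to 2 as d -> 0. *)
  set (x := 1 - 4 * d ^ 2).
  assert (Hx : 0 <= x < 1) by (unfold x; split; nra).
  assert (Hx2 : 0 < 1 - x ^ 2) by (clear - Hx; nra).
  eapply Rbar_le_trans; [ | apply (cesaro_opnorm_ge 1 x Hx)].
  unfold Rbar_le. rewrite Rpower_1 by easy.
  assert (L := cesaro1_deriv_ge x d Hx Hd).
  apply (Rmult_le_compat_l (1 - x ^ 2)) in L; [ | lra].
  replace ((1 - x ^ 2) * ((1 - d) / (1 - x) - / (4 * d))) with ((2 - 4 * d ^ 2) * (1 - 2 * d)) in L.
  - nra.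
  - unfold x. field. split; [lra | ]. apply Rgt_not_eq. nra.
Qed.

Lemma cesaro_opnorm_ge_3_2 alpha : Rbar_le (Finite (3 / 2)) (cesaro_opnorm alpha).
Proof.
  eapply Rbar_le_trans; [ | apply (cesaro_opnorm_ge alpha 0); lra].
  rewrite cesaro1_deriv_0. replace (1 - 0 ^ 2) with 1 by ring.
  unfold Rpower. rewrite ln_1, Rmult_0_r, exp_0. simpl. lra.
Qed.

(** At x = 1 - exp(- y) the weight is at least exp(- alpha y) and the derivative at least (exp y -
    1) / 2. Their product grows like exp((1 - alpha) y), which is bounded below by a linear function
    of [y]. *)
Lemma cesaro_opnorm_infinite alpha : 0 < alpha < 1 -> cesaro_opnorm alpha = p_infty.
Proof.
  intros Ha.
  assert (H : forall y, 0 < y ->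
    Rbar_le (Finite ((1 - alpha) * y / 2)) (cesaro_opnorm alpha)).
  { intros y Hy.
    set (x := 1 - exp (- y)).
    assert (E1 : 0 < exp (- y)) by apply exp_pos.
    assert (E2 : exp (- y) < 1) by (rewrite <- exp_0; apply exp_increasing; lra).
    assert (Hx : 0 <= x < 1) by (unfold x; lra).
    eapply Rbar_le_trans; [ | apply (cesaro_opnorm_ge alpha x Hx)]. simpl.
    assert (L := cesaro1_deriv_ge x (1 / 2) Hx ltac:(lra)).
    replace ((1 - 1 / 2) / (1 - x) - / (4 * (1 / 2))) with (/ 2 * (exp y - 1)) in L.
    2:{ replace (1 - x) with (exp (- y)) by (unfold x; ring).
        rewrite exp_Ropp. assert (X := exp_pos y). field. lra. }
    assert (Pw : exp (- (alpha * y)) <= Rpower (1 - x ^ 2) alpha).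
    { replace (exp (- (alpha * y))) with (Rpower (exp (- y)) alpha)
        by (unfold Rpower; rewrite ln_exp; f_equal; ring).
      apply Rle_Rpower_l; [lra | ]. split; [easy | unfold x; nra]. }
    assert (P1 := exp_pos (- (alpha * y))).
    assert (P2 : exp (- (alpha * y)) < 1) by (rewrite <- exp_0; apply exp_increasing; nra).
    assert (P3 : 1 < exp y) by (rewrite <- exp_0; apply exp_increasing; lra).
    assert (P4 : exp (- (alpha * y)) * exp y = exp ((1 - alpha) * y))
      by (rewrite <- exp_plus; f_equal; ring).
    assert (P5 := exp_ineq1_le ((1 - alpha) * y)).
    assert (P6 : exp (- (alpha * y)) * (/ 2 * (exp y - 1))
                 <= Rpower (1 - x ^ 2) alpha * cesaro1_deriv x)
      by (apply Rmult_le_compat; lra).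
    simpl in P6. lra. }
  destruct (cesaro_opnorm alpha) as [b | | ] eqn:E; [ | easy | exact (False_ind _ (H 1 Rlt_0_1))].
  exfalso.
  (* For this value of [y] the lower bound equals |b| + 1. *)
  assert (Hb : 0 < 2 * (Rabs b + 1) / (1 - alpha)).
  { apply Rdiv_lt_0_compat; [ | lra]. assert (X := Rabs_pos b). lra. }
  specialize (H _ Hb). simpl in H.
  replace ((1 - alpha) * (2 * (Rabs b + 1) / (1 - alpha)) / 2) with (Rabs b + 1) in H by (field; lra).
  assert (X := Rle_abs b). lra.
Qed.

Theorem theorem7p1 :
  (Rbar_le (Finite 3) (cesaro_opnorm 1) /\ Rbar_le (cesaro_opnorm 1) (Finite 4)) /\
  (forall alpha : R, 1 < alpha ->
     Rbar_le (Finite (3 / 2)) (cesaro_opnorm alpha) /\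
     Rbar_le (cesaro_opnorm alpha) (Finite 4)) /\
  (forall alpha : R, 0 < alpha < 1 -> cesaro_opnorm alpha = p_infty).
Proof.
  split; [ | split].
  - split; [apply cesaro_opnorm_1_ge_3 | apply cesaro_opnorm_le_4; lra].
  - intros alpha Ha. split; [apply cesaro_opnorm_ge_3_2 | apply cesaro_opnorm_le_4; lra].
  - exact cesaro_opnorm_infinite.
Qed.
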